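(* For every positive integer $n$ and every set $\mathcal{I}\subset\{(j,k)\in\mathbb{Z}_{\ge0}^2: j+k\le n-1\}$ with $|\mathcal{I}|=n$, $$|MS^2_{\mathcal{I}}|=\pm|MP_{\mathcal{I}}|^3\,\operatorname{Res}_n(x_1,x_2,x_3).$$
   Context: Let $n\ge1$ and let $x_i(s,t,u)=\sum_{j+k\le n}c^i_{jk}s^jt^ku^{n-j-k}$, $i=1,\dots,4$, be four generic homogeneous polynomials of degree $n$ (the $c^i_{jk}$ are independent indeterminates). Let $\mathbb{K}=\mathbb{Q}(c^i_{jk})$ and let $S_l$ be the $\mathbb{K}$-space of homogeneous polynomials of degree $l$ in $s,t,u$. All spaces have monomial bases, each with a fixed order, and matrices are taken in these bases. $|A|$ denotes the determinant of a square matrix $A$, and $x^\gamma=x_1^{\gamma_1}x_2^{\gamma_2}x_3^{\gamma_3}x_4^{\gamma_4}$. $MP$ is the $(2n^2+n)\times(2n^2+2n)$ matrix of $\phi:S_{n-1}^4\to S_{2n-1}$, $(p_1,\dots,p_4)\mapsto\sum_i p_ix_i$. $MP_{\mathcal{I}}$ is the square matrix obtained from $MP$ by removing the $n$ columns corresponding to $s^it^ju^{n-1-i-j}x_4$, $(i,j)\in\mathcal{I}$. Let $\Gamma_0=\{\gamma\in\mathbb{Z}_{\ge0}^4:|\gamma|=2,\ \gamma_4\le1\}$. $MS^2$ is the matrix of $\psi^2:S_{n-1}^{\Gamma_0}\to S_{3n-1}$, $(p_\gamma)\mapsto\sum_{\gamma\in\Gamma_0}p_\gamma x^\gamma$. $MS^2_{\mathcal{I}}$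 is the square matrix obtained from $MS^2$ by removing all columns corresponding to $s^it^ju^{n-1-i-j}x^\gamma$ with $(i,j)\in\mathcal{I}$, $\gamma\in\Gamma_0$, $\gamma_4=1$. $\operatorname{Res}_n(f_1,f_2,f_3)$ is the multivariate resultant of three generic homogeneous polynomials of degree $n$ in three variables: the irreducible polynomial with integer coefficients (unique up to sign) in the coefficients of the $f_i$ which vanishes, after specializing the coefficients in an algebraically closed field $k$, if and only if $f_1=f_2=f_3=0$ has a solution in $\mathbb{P}^2(k)$. *)

(* Defs.v *)
From HB Require Import structures.
From mathcomp Require Import all_boot all_order all_algebra.
From mathcomp Require Import mpoly.
From mathcomp Require Import zify.

Set Implicit Arguments.
Unset Strict Implicit.
Unset Printing Implicit Defensive.

Import GRing.Theory.

Local Open Scope ring_scope.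

(* The pair (j, k) with j + k <= l stands for the monomial
   s^j t^k u^(l - j - k); s, t, u are the variables 0, 1, 2. *)
Definition idx (l : nat) : finType :=
  {p : 'I_l.+1 * 'I_l.+1 | (p.1 + p.2 <= l)%N}.

Definition mon (l : nat) (p : idx l) : 'X_{1..3} :=
  [multinom of [:: nat_of_ord (val p).1; nat_of_ord (val p).2;
                   (l - (val p).1 - (val p).2)%N]].

Lemma mdeg_mon l (p : idx l) : mdeg (mon p) = l.
Proof.
rewrite mdegE !big_ord_recr big_ord0 /= !multinomE !(tnth_nth 0%N) /=.
case: p => -[j k] /=; lia.
Qed.

Lemma mon_homog (A : nzRingType) l (p : idx l) :
  ('X_[mon p] : {mpoly A[3]}) \is l.-homog.
Proof. by rewrite dhomogX; apply/eqP/mdeg_mon. Qed.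

(* The homogeneous form of degree l in three variables with coefficients c. *)
Definition form (A : nzRingType) (l : nat) (c : idx l -> A) : {mpoly A[3]} :=
  \sum_(p : idx l) c p *: 'X_[mon p].

Lemma form_homog (A : nzRingType) l (c : idx l -> A) : form c \is l.-homog.
Proof.
by apply: rpred_sum => p _; apply/rpredZ/mon_homog.
Qed.

Lemma card_idx l : (#|idx l| * 2 = l.+1 * l.+2)%N.
Proof.
rewrite card_sig -sum1_card -(pair_big_dep xpredT
  (fun j k : 'I_l.+1 => (j + k <= l)%N) (fun _ _ => 1%N)) /=.
transitivity ((\sum_(j < l.+1) j.+1) * 2)%N.
  congr (_ * _)%N; rewrite (reindex_inj rev_ord_inj) /=.
  apply: eq_bigr => j _; rewrite sum1_card.
  transitivity #|[pred k : 'I_l.+1 | (k < j.+1)%N]|.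
    by apply: eq_card => k; rewrite !inE /=; have := ltn_ord j; lia.
  rewrite -sum1_card.
  rewrite (eq_bigl (fun k : 'I_l.+1 => (k < j.+1)%N)) //.
  rewrite (big_ord_narrow (ltn_ord j)).
  by rewrite sum1_card card_ord.
elim: (l.+1) => [|m IH]; first by rewrite big_ord0.
by rewrite big_ord_recr /= mulnDl IH; lia.
Qed.

Lemma card_idx_pred l : (0 < l)%N -> (#|idx l.-1| * 2 = l * l.+1)%N.
Proof. by case: l => // l _; apply: card_idx. Qed.

(* The coefficients of m forms of degree n: (i, p) labels the coefficient of
   the monomial p in the i-th form. *)
Definition coef_idx (m n : nat) : finType := ('I_m * idx n)%type.

Section Resultant.

Variable n : nat.

Definition common_zero (k : fieldType) (f : 'I_3 -> {mpoly k[3]}) : Prop :=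
  exists2 a : 'I_3 -> k, (exists i, a i != 0) & forall i, (f i).@[a] = 0.

(* The value of an integer polynomial in the coefficients of three forms of
   degree n at the forms with coefficients c. *)
Definition res_at (A : comNzRingType)
    (R : {mpoly int[#|coef_idx 3 n|]}) (c : 'I_3 -> idx n -> A) : A :=
  mmap intr (fun v => c (enum_val v).1 (enum_val v).2) R.

Definition irreducible (A : idomainType) (a : A) : Prop :=
  [/\ a != 0, a \isn't a GRing.unit &
      forall b c, a = b * c -> b \is a GRing.unit \/ c \is a GRing.unit].

(* This determines R up to sign. *)
Definition is_resultant (R : {mpoly int[#|coef_idx 3 n|]}) : Prop :=
  irreducible R /\
  forall (k : closedFieldType) (c : 'I_3 -> idx n -> k),
    res_at R c = 0 <-> common_zero (fun i => form (c i)).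

End Resultant.

(* In a product basis, the pair (p, j) stands for the element of the power
   S_a^J whose component j is the monomial p and whose other components
   vanish. *)
Section MatrixOfMap.

Variables (K : fieldType) (J : finType) (a b : nat).

Definition monS (l : nat) (p : idx l) : dhomog 3 K l :=
  DHomog (mon_homog K p).

Definition basis_elt (q : idx a * J) : {ffun J -> dhomog 3 K a} :=
  [ffun j => if j == q.2 then monS q.1 else 0].

Definition mx_of_map (T : {linear {ffun J -> dhomog 3 K a} -> dhomog 3 K b}) :
    'M[K]_(#|idx b|, #|{: idx a * J}|) :=
  \matrix_(r, c)
    (mpoly_of_dhomog (T (basis_elt (enum_val c))))@_(mon (enum_val r)).

(* The submatrix on the columns in A, taken in their original order. *)
Definition keep_cols (r : nat) (A : {set idx a * J})
    (M : 'M[K]_(r, #|{: idx a * J}|)) : 'M[K]_(r, #|A|) :=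
  colsub (fun c : 'I_#|A| => enum_rank (enum_val c)) M.

End MatrixOfMap.

Section Multiplication.

Variables (K : fieldType) (J : finType) (a b : nat).
Variable y : J -> {mpoly K[3]}.
Hypothesis y_homog :
  forall (j : J) (p : dhomog 3 K a), mpoly_of_dhomog p * y j \is b.-homog.

Fact mul_map_homog (p : {ffun J -> dhomog 3 K a}) :
  \sum_j mpoly_of_dhomog (p j) * y j \is b.-homog.
Proof. by apply: rpred_sum => j _; apply: y_homog. Qed.

Definition mul_map (p : {ffun J -> dhomog 3 K a}) : dhomog 3 K b :=
  DHomog (mul_map_homog p).

Lemma mul_map_linear : linear mul_map.
Proof.
move=> c p q; apply: val_inj; rewrite /= scaler_sumr -big_split /=.
by apply: eq_bigr => j _; rewrite !ffunE /= mulrDl scalerAl.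
Qed.

HB.instance Definition _ :=
  GRing.isLinear.Build K {ffun J -> dhomog 3 K a} (dhomog 3 K b) _ mul_map
    mul_map_linear.

End Multiplication.

(* {g in Z_{>=0}^4 : |g| = 2, g_4 <= 1}; the index ord_max : 'I_4 plays the
   role of 4. *)
Definition Gamma0 : finType :=
  {g : 'X_{1..4 < 3} | (mdeg g == 2%N) && (g ord_max <= 1)%N}.

Lemma card_Gamma0 :
  #|Gamma0| = 9%N /\ #|[set g : Gamma0 | val g ord_max == 1%N]| = 3%N.
Proof.
pose f (g : Gamma0) : seq nat := val g.
have f_inj : injective f by move=> g h /val_inj/val_inj/val_inj/val_inj.
pose L := [:: [:: 2; 0; 0; 0]; [:: 0; 2; 0; 0]; [:: 0; 0; 2; 0];
              [:: 1; 1; 0; 0]; [:: 1; 0; 1; 0]; [:: 0; 1; 1; 0];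
              [:: 1; 0; 0; 1]; [:: 0; 1; 0; 1]; [:: 0; 0; 1; 1]]%N.
pose C s := [&& size s == 4, sumn s == 2 & nth 0 s 3 <= 1]%N.
have LC s : (s \in L) = C s.
  apply/idP/idP; first by apply: (allP (isT : all C L)).
  case: s => [|a [|b [|c [|d [|]]]]] //=; rewrite /C /= addn0 => /andP[/eqP].
  by case: a b c d => [|[|[|a]]] [|[|[|b]]] [|[|[|c]]] [|[|[|d]]].
have fC g : C (f g).
  have /andP[/eqP dg g4] := valP g.
  have sg : sumn (f g) = 2%N by rewrite -dg sumnE.
  rewrite /C sg size_tuple /=.
  by move: g4; rewrite mnm_tnth (tnth_nth 0%N).
have fL : perm_eq [seq f g | g <- enum Gamma0] L.
  apply: uniq_perm => //; first by rewrite map_inj_uniq ?enum_uniq.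
  move=> s; rewrite LC; apply/mapP/idP => [[g _ ->] //|/and3P[s4 ss s3]].
  pose m : 'X_{1..4} := Multinom (Tuple s4).
  have dm : mdeg m = 2%N by rewrite -[RHS](eqP ss) sumnE.
  have m2 : (mdeg m < 3)%N by rewrite dm.
  have m3 : (mdeg (BMultinom m2) == 2%N) && (bmnm (BMultinom m2) ord_max <= 1)%N.
    by rewrite /= dm /= mnm_tnth (tnth_nth 0%N).
  by exists (exist _ (BMultinom m2) m3); rewrite ?mem_enum.
split; first by rewrite cardE -(size_map f) (perm_size fL).
rewrite cardE -(size_map f) /enum_mem size_map size_filter.
transitivity (count (fun s => nth 0 s 3 == 1)%N L); last by [].
rewrite -(permP fL) count_map enumT.
by apply: eq_count => g; rewrite !inE /= mnm_tnth (tnth_nth 0%N).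
Qed.

Section Generic.

Variable n : nat.

Definition K : fieldType := {fraction {mpoly rat[#|coef_idx 4 n|]}}.

Definition coefx (i : 'I_4) (p : idx n) : K :=
  tofrac 'X_(enum_rank ((i, p) : coef_idx 4 n)).

Definition xform (i : 'I_4) : {mpoly K[3]} := form (coefx i).

Definition xpow (g : 'X_{1..4}) : {mpoly K[3]} := \prod_(i < 4) xform i ^+ g i.

Lemma phi_homog (i : 'I_4) (p : dhomog 3 K n.-1) :
  mpoly_of_dhomog p * xform i \is ((2 * n).-1).-homog.
Proof.
have -> : (2 * n).-1 = (n.-1 + n)%N by lia.
by apply: dhomogM; [apply: dhomog_is_dhomog | apply: form_homog].
Qed.

Lemma xpow_homog (g : 'X_{1..4}) : xpow g \is (n * mdeg g).-homog.
Proof.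
rewrite mdegE big_distrr /= /xpow.
apply: (big_rec2 (fun d p => p \is d.-homog)) => [|i d p _ hp].
  exact: dhomog1.
apply: dhomogM hp; apply: dhomogMn; exact: form_homog.
Qed.

Lemma psi2_homog (g : Gamma0) (p : dhomog 3 K n.-1) :
  mpoly_of_dhomog p * xpow (val g) \is ((3 * n).-1).-homog.
Proof.
have [/eqP dg _] := andP (valP g).
have -> : (3 * n).-1 = (n.-1 + n * mdeg (val g))%N by rewrite dg; lia.
by apply: dhomogM; [apply: dhomog_is_dhomog | apply: xpow_homog].
Qed.

Definition phi : {linear {ffun 'I_4 -> dhomog 3 K n.-1} -> dhomog 3 K (2 * n).-1} :=
  mul_map phi_homog.

Definition psi2 : {linear {ffun Gamma0 -> dhomog 3 K n.-1} -> dhomog 3 K (3 * n).-1} :=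
  mul_map psi2_homog.

Definition MP := mx_of_map phi.

Definition MS2 := mx_of_map psi2.

Variable I : {set idx n.-1}.

Definition MP_cols : {set idx n.-1 * 'I_4} :=
  [set q : idx n.-1 * 'I_4 | ~~ ((q.1 \in I) && (q.2 == ord_max))].

Definition MS2_cols : {set idx n.-1 * Gamma0} :=
  [set q : idx n.-1 * Gamma0 | ~~ ((q.1 \in I) && (val q.2 ord_max == 1%N))].

Hypotheses (n_gt0 : (0 < n)%N) (cardI : #|I| = n).

Lemma MP_square : #|MP_cols| = #|idx (2 * n).-1|.
Proof.
have eqC : ~: MP_cols = setX I [set ord_max].
  by apply/setP => q; rewrite !inE negbK.
have := cardsC MP_cols; rewrite eqC cardsX cards1 cardI card_prod card_ord.
have := card_idx_pred n_gt0; have := @card_idx_pred (2 * n); lia.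
Qed.

Lemma MS2_square : #|MS2_cols| = #|idx (3 * n).-1|.
Proof.
have [c9 c3] := card_Gamma0.
have eqC : ~: MS2_cols = setX I [set g : Gamma0 | val g ord_max == 1%N].
  by apply/setP => q; rewrite !inE negbK.
have := cardsC MS2_cols; rewrite eqC cardsX c3 cardI card_prod c9.
have := card_idx_pred n_gt0; have := @card_idx_pred (3 * n); lia.
Qed.

Definition MP_I : 'M[K]_#|idx (2 * n).-1| :=
  castmx (erefl, MP_square) (keep_cols MP_cols MP).

Definition MS2_I : 'M[K]_#|idx (3 * n).-1| :=
  castmx (erefl, MS2_square) (keep_cols MS2_cols MS2).

End Generic.

Arguments MP_I {n} I n_gt0 cardI.
Arguments MS2_I {n} I n_gt0 cardI.

(* Res_n(x_1, x_2, x_3) in K, where R is the generic resultant. *)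
Definition res_x123 (n : nat) (R : {mpoly int[#|coef_idx 3 n|]}) : K n :=
  res_at R (fun i : 'I_3 => @coefx n (widen_ord (leqnSn 3) i)).

(* Main.v *)
From HB Require Import structures.
From mathcomp Require Import all_boot all_order all_algebra.
From mathcomp Require Import perm closed_field mpoly.
From mathcomp Require Import zify ring.
From Stdlib Require Import Classical FunctionalExtensionality.
Require Import Defs.

(* Let D : S_{2n-1}^3 -> S_{3n-1} be multiplication by (x_1, x_2, x_3) and
   Z : S_{n-1}^3 -> S_{2n-1}^3 the Koszul syzygies, so D Z = 0. There is a
   polynomial K in the coefficients of x_1, x_2, x_3, the determinant of this
   complex, with det (D X) = K det [X | Z] for every X. If X sends the basis
   vector X^p x_i x_j (i <= j) of the domain of psi^2 to X^p x_j in block i, then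
   D X = MS^2_I, while [X | Z] is, up to column operations, a block diagonal
   matrix with three blocks MP_I.

   K is, up to sign, the resultant R. A common zero exists whenever K vanishes:
   otherwise D would have a right inverse X. Hence K divides a power of R (compare
   roots on the pencil through (s^n, t^n, u^n), where K is monic up to sign), and
   K = +- R^j as Z[c] is factorial. Finally K divides 2, while R is even, at the
   forms s u^(n-1) - t^n, t u^(n-1), s^n + 2 u^n, so j = 1. *)

Set Implicit Arguments.
Unset Strict Implicit.
Unset Printing Implicit Defensive.

Import GRing.Theory.

Local Open Scope ring_scope.

(** * Factorial rings *)

(** The quotient [full0 / minor0] is a priori only a rational function. It is a polynomial because
    other complementary rows in place of [E0mx] give the same quotient, and for [E1mx] the new
    denominator shares no prime factor with the old one once the forms are shifted. Adding 'X times
    the pure powers makes [minor0] monic, so it can be cancelled over every ring; putting 'X = 0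
    afterwards gives the determinant identity even at forms where [minor0] vanishes. In degree 3n -
    1 the last Koszul term is S_{-1} = 0, so D and Z are the whole complex, and D is onto for forms
    without common zero. [is_resultant] says nothing about the degree of R, so the exponent j cannot
    be found by counting degrees. It is bounded by a 2-adic valuation at one integral system. For
    this, and to leave only a sign undetermined, K is compared with R in Z[c] and not over a
    field. *)

Section Factorial.

Variable A : idomainType.

Definition divides (a b : A) := exists c, b = c * a.

Definition prime_elt (p : A) : Prop :=
  [/\ p != 0, p \isn't a GRing.unit &
      forall a b, divides p (a * b) -> divides p a \/ divides p b].

Definition prime_product (a : A) : Prop :=
  exists u (s : seq A),
    [/\ u \is a GRing.unit, forall p, p \in s -> prime_elt p
      & a = u * \prod_(p <- s) p].

Definition factorial_ring := forall a : A, a != 0 -> prime_product a.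

Lemma divides_mull a b c : divides a b -> divides a (c * b).
Proof. by case=> d ->; exists (c * d); rewrite mulrA. Qed.

Lemma divides_mulr a b c : divides a b -> divides a (b * c).
Proof. by rewrite mulrC; apply: divides_mull. Qed.

Lemma dividesD a b c : divides a b -> divides a c -> divides a (b + c).
Proof. by case=> d -> [e ->]; exists (d + e); rewrite mulrDl. Qed.

Lemma dividesN a b : divides a b -> divides a (- b).
Proof. by case=> d ->; exists (- d); rewrite mulNr. Qed.

Lemma prime_product_unit u : u \is a GRing.unit -> prime_product u.
Proof. by move=> uu; exists u, [::]; split=> //; rewrite big_nil mulr1. Qed.

Lemma prime_product_prime p : prime_elt p -> prime_product p.
Proof.
move=> pp; exists 1, [:: p]; split; rewrite ?unitr1 // ?big_seq1 ?mul1r //.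
by move=> q; rewrite inE => /eqP ->.
Qed.

Lemma prime_productM a b :
  prime_product a -> prime_product b -> prime_product (a * b).
Proof.
move=> [u [s [uu ps ->]]] [v [t [uv pt ->]]]; exists (u * v), (s ++ t).
split; first by rewrite unitrM uu.
  by move=> p; rewrite mem_cat => /orP[/ps|/pt].
by rewrite big_cat mulrACA.
Qed.

Lemma prime_elt_assoc p u : u \is a GRing.unit -> prime_elt p -> prime_elt (u * p).
Proof.
move=> uu [p0 pu pP]; have dvdu a : divides (u * p) a <-> divides p a.
  split=> -[c ->]; first by exists (c * u); rewrite mulrA.
  by exists (c / u); rewrite mulrA divrK.
split; first by rewrite mulf_neq0 //; apply: contraTneq uu => ->; rewrite unitr0.
  by rewrite unitrM negb_and pu orbT.
by move=> a b /dvdu /pP[] h; [left | right]; apply/dvdu.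
Qed.

Lemma prime_elt_irreducible p a b : prime_elt p -> p = a * b ->
  a \is a GRing.unit \/ b \is a GRing.unit.
Proof.
case=> p0 pu pP e.
have [|[c ec]|[c ec]] := pP a b; first by exists 1; rewrite mul1r e.
  right; apply/unitrPr; exists c; apply: (mulfI p0); apply/esym.
  by rewrite mulr1 {1}e ec; ring.
left; apply/unitrPr; exists c; apply: (mulfI p0); apply/esym.
by rewrite mulr1 {1}e ec; ring.
Qed.

Lemma prime_elt_prod p s : prime_elt p -> divides p (\prod_(q <- s) q) ->
  exists2 q, q \in s & divides p q.
Proof.
case=> p0 pu pP; elim: s => [|q s IH].
  rewrite big_nil => -[c e]; case/negP: pu; apply/unitrPr.
  by exists c; rewrite mulrC -e.
rewrite big_cons => /pP[h|/IH[r rs h]]; first by exists q; rewrite ?mem_head.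
by exists r; rewrite ?inE ?rs ?orbT.
Qed.

Lemma irreducible_prime a : factorial_ring -> irreducible a -> prime_elt a.
Proof.
move=> fA [a0 au aP]; have [u [s [uu ps ea]]] := fA a a0.
case: s => [|p s] in ps ea *.
  by rewrite ea big_nil mulr1 uu in au.
have pp : prime_elt p by apply: ps; rewrite mem_head.
have e : a = (u * \prod_(q <- s) q) * p by rewrite ea big_cons; ring.
have [//|up] := aP _ _ e; first by move=> u'; rewrite e; apply: prime_elt_assoc.
by case: pp => _ /negP.
Qed.

Lemma dvd_prime_exp p r a b : prime_elt p -> a * b = p ^+ r ->
  exists u j, u \is a GRing.unit /\ a = u * p ^+ j.
Proof.
move=> pp; have [p0 pu pP] := pp; elim: r a b => [|r IH] a b.
  rewrite expr0 => e; exists a, 0%N; rewrite expr0 mulr1; split=> //.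
  by apply/unitrPr; exists b.
rewrite exprS => e; have [|[c ec]|[c ec]] := pP a b.
- by exists (p ^+ r); rewrite e mulrC.
- have [|u [j [uu ej]]] := IH c b.
    by apply: (mulfI p0); rewrite -e ec; ring.
  by exists u, j.+1; rewrite ec ej exprSr mulrA.
have [|u [j [uu ej]]] := IH a c; last by exists u, j.
by apply: (mulfI p0); rewrite -e ec; ring.
Qed.

End Factorial.

Lemma factorial_ring_iso (A B : idomainType) (f : {rmorphism A -> B})
    (g : {rmorphism B -> A}) :
  cancel f g -> cancel g f -> factorial_ring A -> factorial_ring B.
Proof.
move=> fK gK fA b b0.
have fu a : (f a \is a GRing.unit) = (a \is a GRing.unit).
  by apply/idP/idP => [h|]; [rewrite -(fK a); apply: rmorph_unit | apply: rmorph_unit].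
have fp a : prime_elt a -> prime_elt (f a).
  case=> a0 au aP; split; rewrite ?fu // ?(can_eq fK).
    by rewrite -(rmorph0 f) (can_eq fK).
  move=> x y [c e].
  have [|[d ed]|[d ed]] := aP (g x) (g y).
  - by exists (g c); rewrite -rmorphM e rmorphM fK.
  - by left; exists (f d); rewrite -rmorphM -ed gK.
  by right; exists (f d); rewrite -rmorphM -ed gK.
have ga0 : g b != 0 by rewrite -(rmorph0 g) (can_eq gK).
have [u [s [uu ps e]]] := fA _ ga0.
exists (f u), (map f s); split; rewrite ?fu //.
  by move=> p /mapP[q qs ->]; apply/fp/ps.
by rewrite big_map -rmorph_prod -rmorphM -e gK.
Qed.

(** * Gauss's lemma over a factorial ring *)

Section FactorialPoly.

Variable A : idomainType.
Hypothesis fA : factorial_ring A.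

Implicit Types (f g h : {poly A}) (s : seq A).

Lemma size_scale_neq0 (c : A) f : c != 0 -> size (c *: f) = size f.
Proof. by move=> c0; rewrite size_scale. Qed.

Lemma scale_poly_inj (c : A) f g : c != 0 -> c *: f = c *: g -> f = g.
Proof. by rewrite -!mul_polyC => c0; apply: mulfI; rewrite polyC_eq0. Qed.

(* Strip the leading terms: if p divides f g, it divides the leading coefficient
   of f or of g. *)
Lemma prime_elt_polyC (p : A) : prime_elt p -> prime_elt p%:P.
Proof.
case=> p0 pu pP; split; first by rewrite polyC_eq0.
  by rewrite poly_unitE size_polyC p0 coefC eqxx.
move=> f g; have [k] := ubnP (size f + size g)%N.
elim: k f g => // k IH f g lek [c ec].
have [->|f0] := eqVneq f 0; first by left; exists 0; rewrite mul0r.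
have [->|g0] := eqVneq g 0; first by right; exists 0; rewrite mul0r.
pose top (h : {poly A}) := (lead_coef h)%:P * 'X^((size h).-1).
have size_tail h : h != 0 -> (size (h - top h)%R < size h)%N.
  move=> h0; have sh : (0 < size h)%N by rewrite lt0n size_poly_eq0.
  rewrite -(prednK sh) ltnS; apply/leq_sizeP => j lej.
  rewrite coefB coefCM coefXn; case: eqP => [->|/eqP nj].
    by rewrite mulr1 lead_coefE subrr.
  by rewrite mulr0 subr0 nth_default // -(prednK sh) ltn_neqAle eq_sym nj.
have [|[d ed]|[d ed]] := pP (lead_coef f) (lead_coef g).
- by exists (lead_coef c); rewrite -lead_coefM ec lead_coefM lead_coefC.
- have ptop : divides p%:P (top f).
    by rewrite /top ed polyCM; apply: divides_mulr; exists d%:P.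
  have [||h|h] := IH (f - top f) g; last by right.
  + by rewrite -ltnS (leq_trans _ lek) // ltnS ltn_add2r size_tail.
  + rewrite mulrBl; apply: dividesD; first by exists c.
    by apply/dividesN/divides_mulr.
  by left; rewrite -(subrK (top f) f); apply: dividesD.
have ptop : divides p%:P (top g).
  by rewrite /top ed polyCM; apply: divides_mulr; exists d%:P.
have [||h|h] := IH f (g - top g); first by rewrite -ltnS (leq_trans _ lek) // ltnS ltn_add2l size_tail.
- rewrite mulrBr; apply: dividesD; first by exists c.
  by apply/dividesN/divides_mull.
- by left.
by right; rewrite -(subrK (top g) g); apply: dividesD.
Qed.

(** A prime factor of c stays prime among polynomials, so it divides g or h and can be cancelled
    there without changing a degree. This turns a factorization up to a scalar into one over A. *)
Lemma cancel_content (c : A) f g h : c != 0 -> c *: f = g * h ->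
  exists g' h', [/\ f = g' * h', size g' = size g & size h' = size h].
Proof.
move=> c0; have [u [s [uu ps ->]]] := fA c0.
rewrite -scalerA => /(congr1 ( *:%R u^-1)); rewrite [LHS]scalerA mulVr // scale1r scalerAl.
have <- : size (u^-1 *: g) = size g.
  by apply: size_scale_neq0; apply: contraTneq uu => /eqP;
     rewrite invr_eq0 => /eqP ->; rewrite unitr0.
move: (_ *: g) => {c c0 u uu} {}g.
elim: s g h ps => [|p s IH] g h ps.
  by rewrite big_nil scale1r => e; exists g, h.
have pp : prime_elt p by apply: ps; rewrite mem_head.
have [p0 _ _] := pp.
rewrite big_cons -scalerA => e.
have ps' q : q \in s -> prime_elt q by move=> qs; apply: ps; rewrite inE qs orbT.
have [_ _ pP] := prime_elt_polyC pp.
have [|[g1 eg]|[h1 eh]] := pP g h.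
- by exists ((\prod_(j <- s) j) *: f); rewrite -e -mul_polyC mulrC.
- have [|g' [h' [? sg ?]]] := IH g1 h ps'.
    apply: (scale_poly_inj p0); rewrite e eg -mul_polyC; ring.
  exists g', h'; split=> //.
  by rewrite sg eg mulrC mul_polyC size_scale_neq0.
have [|g' [h' [? ? sh]]] := IH g h1 ps'.
  apply: (scale_poly_inj p0); rewrite e eh -mul_polyC; ring.
exists g', h'; split=> //.
by rewrite sh eh mulrC mul_polyC size_scale_neq0.
Qed.

(** Phrased through prime constants and not through a gcd of the coefficients: the proofs cancel one
    prime at a time. *)
Definition primitive_poly f := forall p : A, prime_elt p -> ~ divides p%:P f.

(** The primes of c are removed one by one; none can divide f, so each divides q. *)
Lemma primitive_cancel (c : A) f g q : primitive_poly f -> c != 0 ->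
  c *: g = q * f -> divides f g.
Proof.
move=> fpr c0; have [u [s [uu ps ->]]] := fA c0.
rewrite -scalerA => /(congr1 ( *:%R u^-1)); rewrite [LHS]scalerA mulVr // scale1r scalerAl.
move: (_ *: q) => {c c0 u uu} {}q.
elim: s q ps => [|p s IH] q ps.
  by rewrite big_nil scale1r => e; exists q.
have pp : prime_elt p by apply: ps; rewrite mem_head.
have [p0 _ _] := pp.
rewrite big_cons -scalerA => e.
have [_ _ pP] := prime_elt_polyC pp.
have [|[q1 eq1]|/fpr //] := pP q f.
  by exists ((\prod_(j <- s) j) *: g); rewrite -e -mul_polyC mulrC.
apply: (IH q1); first by move=> r rs; apply: ps; rewrite inE rs orbT.
by apply: (scale_poly_inj p0); rewrite e eq1 -mul_polyC; ring.
Qed.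

(* The primes that can be extracted divide the leading coefficient. *)
Lemma primitive_part f : f != 0 ->
  exists2 g, primitive_poly g & exists2 s,
    forall p, p \in s -> prime_elt p & f = (\prod_(p <- s) p)%:P * g.
Proof.
move=> f0; have lf0 : lead_coef f != 0 by rewrite lead_coef_eq0.
have [u [t [uu pt et]]] := fA lf0.
have [k] := ubnP (size t); elim: k f f0 {lf0} u t uu pt et => // k IH f f0 u t uu pt et lt_t.
have [fpr|] := classic (primitive_poly f).
  by exists f => //; exists [::] => //; rewrite big_nil mul1r.
move=> /not_all_ex_not[p /not_all_ex_not[pp /NNPP[g eg]]].
have [p0 pu pP] := pp.
have g0 : g != 0 by apply: contraNneq f0 => g0; rewrite eg g0 mul0r.
have lfg : lead_coef f = lead_coef g * p by rewrite eg lead_coefM lead_coefC.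
have [|q qt [d ed]] := @prime_elt_prod _ p t pp.
  exists (u^-1 * lead_coef g); rewrite -mulrA -lfg et mulKr //.
have [du|//] := prime_elt_irreducible (pt q qt) ed; last by rewrite (negPf pu).
have et' : lead_coef g = (u * d) * \prod_(r <- rem q t) r.
  apply: (mulIf p0); rewrite -lfg et (perm_big _ (perm_to_rem qt)) big_cons ed /=.
  by ring.
have [| | |h hpr [s ps es]] := IH g g0 (u * d) (rem q t) _ _ et'.
- by rewrite unitrM uu.
- by move=> r /mem_rem /pt.
- by rewrite size_rem //; case: (t) qt lt_t.
exists h => //; exists (p :: s).
  by move=> r; rewrite inE => /orP[/eqP ->//|/ps].
by rewrite eg es big_cons polyCM; ring.
Qed.

Lemma primitive_dvd f g h : f = g * h -> primitive_poly f -> primitive_poly g.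
Proof. by move=> -> fpr p /fpr fp gp; apply/fp/divides_mulr. Qed.

(** [f %| g] is divisibility up to a scalar, as over the fraction field. In that sense f is
    irreducible, since [cancel_content] would lift a proper factorization, and therefore prime;
    [primitive_cancel] brings divisibility back to A. *)
Lemma primitive_prime f : primitive_poly f -> (1 < size f)%N ->
    (forall g h, f = g * h -> (size g <= 1)%N \/ (size h <= 1)%N) ->
  prime_elt f.
Proof.
move=> fpr f1 fi; have f0 : f != 0 by rewrite -size_poly_gt0; lia.
have firr : irreducible_poly f.
  split=> // q q1 qf; case/Pdiv.Idomain.dvdpP: (qf) => -[c r] /= c0.
  move=> /(cancel_content c0)[r' [q' [e sr sq]]].
  have [r1|qs1] := fi _ _ e; last first.
    have q0 : (0 < size q)%N.
      by rewrite -sq size_poly_gt0; apply: contraNneq f0 => q0; rewrite e q0 mulr0.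
    by move: q1; rewrite -sq; lia.
  rewrite -dvdp_size_eqp // -sq e size_mul; last first.
  - by apply: contraNneq f0 => q0; rewrite e q0 mulr0.
  - by apply: contraNneq f0 => q0; rewrite e q0 mul0r.
  have : (0 < size r')%N.
    by rewrite size_poly_gt0; apply: contraNneq f0 => q0; rewrite e q0 mul0r.
  by move: (size r') r1 => [|[|]] //.
have dvdf g : f %| g -> divides f g.
  by case/Pdiv.Idomain.dvdpP=> -[c r] /= c0 e; apply: primitive_cancel e.
split=> //; first by rewrite poly_unitE gtn_eqF.
move=> g h [c e].
have : f %| g * h by rewrite e dvdp_mulIr.
have [cfg|] := boolP (coprimep f g).
  by rewrite Gauss_dvdpr // => /dvdf; right.
move=> ncop _; left; apply: dvdf.
have /andP[_ fg] := firr.2 _ ncop (dvdp_gcdl f g).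
exact: dvdp_trans fg (dvdp_gcdr _ _).
Qed.

Lemma primitive_product f : f != 0 -> primitive_poly f -> prime_product f.
Proof.
have [k] := ubnP (size f); elim: k f => // k IH f lek f0 fpr.
have [f1|f1] := leqP (size f) 1.
  (* A primitive constant is a unit: any prime factor of it would divide f. *)
  move: f0 fpr; rewrite (size1_polyC f1) polyC_eq0; move: (f`_0) => a a0 fpr.
  have [u [s [uu ps ea]]] := fA a0; case: s => [|p s] in ps ea *.
    by apply: prime_product_unit; rewrite ea big_nil mulr1 rmorph_unit.
  case: (fpr p); first by apply: ps; rewrite mem_head.
  by exists (u * \prod_(q <- s) q)%:P; rewrite -polyCM ea big_cons; congr _%:P; ring.
have [fi|] := classic (forall g h, f = g * h -> (size g <= 1)%N \/ (size h <= 1)%N).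
  exact/prime_product_prime/primitive_prime.
move=> /not_all_ex_not[g /not_all_ex_not[h fgh]].
have [e /not_or_and[/negP sg /negP sh]] := imply_to_and _ _ fgh.
have g0 : g != 0 by apply: contraNneq f0 => z; rewrite e z mul0r.
have h0 : h != 0 by apply: contraNneq f0 => z; rewrite e z mulr0.
have es : size f = (size g + size h).-1 by rewrite e size_mul.
rewrite e; apply: prime_productM; apply: IH => //; try lia.
  exact: primitive_dvd e fpr.
by move: e; rewrite mulrC => e; exact: primitive_dvd e fpr.
Qed.

Lemma factorial_poly : factorial_ring {poly A}.
Proof.
move=> f f0; have [g gpr [s ps e]] := primitive_part f0.
have g0 : g != 0 by apply: contraNneq f0 => z; rewrite e z mulr0.
rewrite e; apply: prime_productM; last exact: primitive_product.
exists 1, [seq p%:P | p <- s]; split; rewrite ?unitr1 //.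
  by move=> p /mapP[q qs ->]; apply/prime_elt_polyC/ps.
by rewrite mul1r big_map rmorph_prod.
Qed.

End FactorialPoly.

(** * From iterated univariate polynomials to multivariate ones *)

Section PolyOfMpoly.

Variables (n : nat) (B : idomainType).

(** Inverse of [muni], which singles out the last variable; it carries factoriality over to one more
    variable. *)
Definition poly_mpoly : {poly {mpoly B[n]}} -> {mpoly B[n.+1]} :=
  @horner_morph _ _ (@mwiden n B) 'X_ord_max (fun a => mulrC _ _).

HB.instance Definition _ := GRing.RMorphism.on poly_mpoly.

Lemma muniXm (m : 'X_{1..n.+1}) :
  muni ('X_[m] : {mpoly B[n.+1]}) =
  'X_[[multinom (m (widen_ord (leqnSn n) i)) | i < n]] *: 'X^(m ord_max).
Proof. by rewrite muniE msuppX big_seq1 mcoeffX eqxx scale1r. Qed.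

Lemma muniK : cancel (@muni n B) poly_mpoly.
Proof.
move=> p; rewrite (mpolyE p) (raddf_sum (@muni n B)) (raddf_sum poly_mpoly) /=.
apply: eq_bigr => m _; rewrite muniZ muniXm -!mul_polyC !rmorphM /= rmorphXn /=.
rewrite /poly_mpoly !horner_morphC horner_morphX /= mwidenC mwidenX.
rewrite mpolyXn -mpolyXD mul_mpolyC; congr (_ *: 'X_[_]).
apply/mnmP => i; rewrite mnmDE mulmnE mnm1E.
have [[j ->]|->] : (exists j, i = widen_ord (leqnSn n) j) \/ i = ord_max.
- have [lt|ge] := ltnP i n; first by left; exists (Ordinal lt); apply: val_inj.
  by right; apply: val_inj => /=; have := ltn_ord i; lia.
- rewrite mnmwiden_widen mnmE -val_eqE /=.
  by rewrite (gtn_eqF (ltn_ord j)) mul0n addn0.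
by rewrite mnmwiden_ordmax eqxx mul1n.
Qed.

Lemma poly_mpolyK : cancel poly_mpoly (@muni n B).
Proof.
move=> p; rewrite -(coefK p) poly_def (rmorph_sum poly_mpoly) (rmorph_sum (@muni n B)) /=.
apply: eq_bigr => i _; rewrite -mul_polyC !rmorphM !rmorphXn /=; congr (_ * _ ^+ _).
  rewrite /poly_mpoly horner_morphC /=; move: (p`_i) => a.
  rewrite (mpolyE a) (raddf_sum (@mwiden n B)) (raddf_sum (@muni n B)).
  rewrite (raddf_sum polyC) /=; apply: eq_bigr => m _.
  rewrite mwidenZ mwidenX muniZ muniXm mnmwiden_ordmax expr0 alg_polyC.
  rewrite -mul_polyC -polyCM mul_mpolyC; congr (_ *: 'X_[_])%:P.
  by apply/mnmP => j; rewrite mnmE mnmwiden_widen.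
rewrite /poly_mpoly horner_morphX muniXm mnm1E eqxx expr1.
rewrite (_ : [multinom _ | _ < _] = 0%MM) ?mpolyX0 ?scale1r //.
apply/mnmP => j; rewrite mnmE mnm1E mnm0E -val_eqE /=.
by rewrite (gtn_eqF (ltn_ord j)).
Qed.

End PolyOfMpoly.

Lemma int_unitE (a : int) : (a \is a GRing.unit) = (`|a|%N == 1%N).
Proof. by rewrite (_ : (a \is a GRing.unit) = (a == 1) || (a == -1)) //; lia. Qed.

Lemma factorial_int : factorial_ring int.
Proof.
move=> a; have [k] := ubnP `|a|%N; elim: k a => // k IH a lek a0.
have [a1|a1] := eqVneq `|a|%N 1%N.
  by apply: prime_product_unit; rewrite int_unitE; lia.
have gt1 : (1 < `|a|)%N by lia.
set p := pdiv `|a|; have pp : prime p by apply: pdiv_prime.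
have [b eb] : exists b : int, a = b * p%:Z.
  by apply/dvdzP; rewrite dvdzE absz_nat pdiv_dvd.
have b0 : b != 0 by apply: contraNneq a0 => z; rewrite eb z mul0r.
have p1 := prime_gt1 pp.
rewrite eb; apply: prime_productM.
  apply: IH => //; rewrite eb abszM absz_nat in lek.
  by apply: leq_trans (lek : (_ <= k)%N); rewrite ltn_Pmulr // absz_gt0.
apply: prime_product_prime; split; first by lia.
  by rewrite int_unitE; lia.
have dvdE x : divides p%:Z x <-> (p%:Z %| x)%Z.
  by split=> [[c ->]|/dvdzP[c ->]]; [apply: dvdz_mull | exists c].
move=> x y /dvdE; rewrite dvdzE abszM absz_nat Euclid_dvdM // => /orP[] h.
  by left; apply/dvdE; rewrite dvdzE absz_nat.
by right; apply/dvdE; rewrite dvdzE absz_nat.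
Qed.

Lemma factorial_mpoly_int n : factorial_ring {mpoly int[n]}.
Proof.
elim: n => [|n IH].
  apply: (@factorial_ring_iso _ _ (@mpolyC 0 int) (@mcoeff 0 int 0%MM)).
  - by move=> c; rewrite /= mcoeffC eqxx mulr1.
  - exact: mpolyKC.
  exact: factorial_int.
apply: (@factorial_ring_iso _ _ (@poly_mpoly n int) (@muni n int)).
- exact: poly_mpolyK.
- exact: muniK.
exact: factorial_poly.
Qed.

(** * Multiplication matrices and the Koszul complex *)

Section Monomials.

Definition tri (a b c : nat) : 'X_{1..3} := [multinom of [:: a; b; c]].

Lemma triE a b c : (tri a b c ord0 = a) * (tri a b c (lift ord0 ord0) = b)
  * (tri a b c ord_max = c).
Proof. by rewrite !multinomE !(tnth_nth 0%N). Qed.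

Lemma mnm3P (m1 m2 : 'X_{1..3}) :
  m1 ord0 = m2 ord0 -> m1 (lift ord0 ord0) = m2 (lift ord0 ord0) ->
  m1 ord_max = m2 ord_max -> m1 = m2.
Proof.
move=> h0 h1 h2; apply/mnmP; case=> [[|[|[|//]]] lt].
- by have -> : Ordinal lt = ord0 by apply: val_inj.
- by have -> : Ordinal lt = lift ord0 ord0 by apply: val_inj.
- by have -> : Ordinal lt = ord_max by apply: val_inj.
Qed.

Lemma tri_eta (m : 'X_{1..3}) : m = tri (m ord0) (m (lift ord0 ord0)) (m ord_max).
Proof. by apply: mnm3P; rewrite triE. Qed.

Lemma mdeg3 (m : 'X_{1..3}) :
  mdeg m = (m ord0 + m (lift ord0 ord0) + m ord_max)%N.
Proof.
rewrite mdegE !big_ord_recr big_ord0 /= add0n; congr (_ + _ + _)%N;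
  by congr (m _); apply: val_inj.
Qed.

Lemma monE l (p : idx l) :
  mon p = tri (val p).1 (val p).2 (l - (val p).1 - (val p).2).
Proof. by []. Qed.

Lemma mon_inj l : injective (@mon l).
Proof.
move=> p p' e; apply: val_inj; apply/eqP; rewrite -pair_eqE /= -!val_eqE /=.
have := congr1 (fun m : 'X_{1..3} => m ord0) e.
have := congr1 (fun m : 'X_{1..3} => m (lift ord0 ord0)) e.
by rewrite !monE !triE => -> ->; rewrite !eqxx.
Qed.

Lemma mon_surj l (m : 'X_{1..3}) : mdeg m = l -> {p : idx l | mon p = m}.
Proof.
rewrite mdeg3 => e.
have h0 : (m ord0 < l.+1)%N by lia.
have h1 : (m (lift ord0 ord0) < l.+1)%N by lia.
have h : (Ordinal h0 + Ordinal h1 <= l)%N by rewrite /=; lia.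
exists (exist _ (Ordinal h0, Ordinal h1) h).
by apply: mnm3P; rewrite monE triE /=; lia.
Qed.

End Monomials.

Section MulMatrix.

Variable R : comNzRingType.

Lemma form_coef l (p : {mpoly R[3]}) : p \is l.-homog ->
  p = form (fun q : idx l => p@_(mon q)).
Proof.
move=> hp; apply/mpolyP => m; rewrite /form raddf_sum /=.
have [dm|dm] := eqVneq (mdeg m) l.
  have [q <-] := mon_surj dm.
  rewrite (bigD1 q) //= mcoeffZ mcoeffX eqxx mulr1 big1 ?addr0 // => i iq.
  by rewrite mcoeffZ mcoeffX (inj_eq (@mon_inj l)) (negPf iq) mulr0.
rewrite (dhomog_nemf_coeff hp dm) big1 // => i _.
rewrite mcoeffZ mcoeffX; case: eqP => [e|_]; last by rewrite mulr0.
by case/eqP: dm; rewrite -e mdeg_mon.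
Qed.

Lemma mcoeff_form l (c : idx l -> R) q : (form c)@_(mon q) = c q.
Proof.
rewrite /form raddf_sum /= (bigD1 q) //= mcoeffZ mcoeffX eqxx mulr1 big1 ?addr0 //.
by move=> i iq; rewrite mcoeffZ mcoeffX (inj_eq (@mon_inj l)) (negPf iq) mulr0.
Qed.

Definition vec l (p : {mpoly R[3]}) : 'cV[R]_#|idx l| :=
  \col_i p@_(mon (enum_val i)).

Definition pol l (v : 'cV[R]_#|idx l|) : {mpoly R[3]} :=
  form (fun q => v (enum_rank q) 0).

Lemma pol_homog l (v : 'cV_#|idx l|) : pol v \is l.-homog.
Proof. exact: form_homog. Qed.

Lemma polK l (v : 'cV_#|idx l|) : vec l (pol v) = v.
Proof. by apply/colP => i; rewrite mxE mcoeff_form enum_valK. Qed.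

Lemma vecK l p : p \is l.-homog -> pol (vec l p) = p.
Proof.
move=> hp; rewrite [RHS](form_coef hp); apply: eq_bigr => q _.
by rewrite mxE enum_rankK.
Qed.

Lemma vec_inj l p q : p \is l.-homog -> q \is l.-homog -> vec l p = vec l q -> p = q.
Proof. by move=> hp hq e; rewrite -(vecK hp) e vecK. Qed.

Lemma vecD l p q : vec l (p + q) = vec l p + vec l q.
Proof. by apply/colP => i; rewrite !mxE mcoeffD. Qed.

Lemma vecZ l c p : vec l (c *: p) = c *: vec l p.
Proof. by apply/colP => i; rewrite !mxE mcoeffZ. Qed.

Lemma vec0 l : vec l 0 = 0.
Proof. by apply/colP => i; rewrite !mxE mcoeff0. Qed.

Lemma vec_sum l (J : Type) (s : seq J) (P : pred J) F :
  vec l (\sum_(j <- s | P j) F j) = \sum_(j <- s | P j) vec l (F j).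
Proof. exact: (big_morph _ (vecD l) (vec0 l)). Qed.

(** [vec l'] reads only the coefficients in degree l', so the matrix makes sense for any F;
    composition, [MulM], is where the degrees must match. *)
Definition Mul l l' (F : {mpoly R[3]}) : 'M[R]_(#|idx l'|, #|idx l|) :=
  \matrix_(r, c) ('X_[mon (enum_val c)] * F)@_(mon (enum_val r)).

Lemma col_Mul l l' F c :
  col c (Mul l l' F) = vec l' ('X_[mon (enum_val c)] * F).
Proof. by apply/colP => r; rewrite !mxE. Qed.

Lemma Mul_vec l l' F p : p \is l.-homog -> Mul l l' F *m vec l p = vec l' (p * F).
Proof.
move=> hp; rewrite [in RHS](form_coef hp) /form mulr_suml vec_sum.
apply/colP => r; rewrite mxE summxE [RHS](reindex_onto enum_val enum_rank) /=; last first.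
  by move=> i _; rewrite enum_rankK.
apply: eq_big => [i|i _]; first by rewrite enum_valK eqxx.
by rewrite -scalerAl !mxE mcoeffZ mulrC.
Qed.

Lemma MulD l l' F G : Mul l l' (F + G) = Mul l l' F + Mul l l' G.
Proof. by apply/matrixP => r c; rewrite !mxE mulrDr mcoeffD. Qed.

Lemma MulZ l l' k F : Mul l l' (k *: F) = k *: Mul l l' F.
Proof. by apply/matrixP => r c; rewrite !mxE -scalerAr mcoeffZ. Qed.

Lemma MulM l l' l'' e F G : F \is e.-homog -> (l + e = l')%N ->
  Mul l' l'' G *m Mul l l' F = Mul l l'' (F * G).
Proof.
move=> hF el; apply/matrixP => r c.
have hp : 'X_[mon (enum_val c)] * F \is l'.-homog.
  by rewrite -el; apply: dhomogM => //; apply: mon_homog.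
rewrite [RHS]mxE mulrA.
have /colP/(_ r) := Mul_vec l'' G hp; rewrite mxE [RHS]mxE => <-.
by rewrite mxE; apply: eq_bigr => i _; rewrite !mxE.
Qed.

Lemma Mul_comm l l' l'' e F G : F \is e.-homog -> G \is e.-homog ->
  (l + e = l')%N ->
  Mul l' l'' G *m Mul l l' F = Mul l' l'' F *m Mul l l' G.
Proof. by move=> hF hG el; rewrite !(MulM _ (e := e)) // mulrC. Qed.

Definition blk m n (F1 F2 F3 : 'M[R]_(m, n)) : 'M_(m, n + (n + n)) :=
  row_mx F1 (row_mx F2 F3).

(** The second Koszul differential: the column blocks belong to the pairs (1,2), (1,3), (2,3), with
    F_j in block i and -F_i in block j. *)
Definition koszul m n (F1 F2 F3 : 'M[R]_(m, n)) : 'M_(m + (m + m), n + (n + n)) :=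
  col_mx (blk F2 F3 0) (col_mx (blk (- F1) 0 F3) (blk 0 (- F1) (- F2))).

Lemma blk_mul m n p (F1 F2 F3 : 'M[R]_(m, n)) (G1 G2 G3 : 'M[R]_(n, p)) :
  blk F1 F2 F3 *m col_mx G1 (col_mx G2 G3) = F1 *m G1 + (F2 *m G2 + F3 *m G3).
Proof. by rewrite /blk !mul_row_col. Qed.

Lemma mul_blk m n p (A : 'M[R]_(p, m)) (F1 F2 F3 : 'M[R]_(m, n)) :
  A *m blk F1 F2 F3 = blk (A *m F1) (A *m F2) (A *m F3).
Proof. by rewrite /blk !mul_mx_row. Qed.

Lemma blkD m n (F1 F2 F3 G1 G2 G3 : 'M[R]_(m, n)) :
  blk F1 F2 F3 + blk G1 G2 G3 = blk (F1 + G1) (F2 + G2) (F3 + G3).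
Proof. by rewrite /blk !add_row_mx. Qed.

Lemma blkZ m n k (F1 F2 F3 : 'M[R]_(m, n)) :
  k *: blk F1 F2 F3 = blk (k *: F1) (k *: F2) (k *: F3).
Proof. by rewrite /blk !scale_row_mx. Qed.

Lemma koszulD m n (F1 F2 F3 G1 G2 G3 : 'M[R]_(m, n)) :
  koszul F1 F2 F3 + koszul G1 G2 G3 = koszul (F1 + G1) (F2 + G2) (F3 + G3).
Proof. by rewrite /koszul !add_col_mx !blkD !opprD !addr0. Qed.

Lemma koszulZ m n k (F1 F2 F3 : 'M[R]_(m, n)) :
  k *: koszul F1 F2 F3 = koszul (k *: F1) (k *: F2) (k *: F3).
Proof. by rewrite /koszul !scale_col_mx !blkZ !scalerN !scaler0. Qed.

End MulMatrix.

Section MapMul.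

Variables (R S : comNzRingType) (f : {rmorphism R -> S}).

Lemma map_form l (c : idx l -> R) : map_mpoly f (form c) = form (f \o c).
Proof.
rewrite /form rmorph_sum /=; apply: eq_bigr => q _.
by rewrite map_mpolyZ map_mpolyX.
Qed.

Lemma map_Mul l l' (F : {mpoly R[3]}) :
  map_mx f (Mul l l' F) = Mul l l' (map_mpoly f F).
Proof.
apply/matrixP => r c; rewrite !mxE -(map_mpolyX f) -rmorphM /=.
by rewrite mcoeff_map_mpoly.
Qed.

Lemma map_blk m n (F1 F2 F3 : 'M[R]_(m, n)) :
  map_mx f (blk F1 F2 F3) = blk (map_mx f F1) (map_mx f F2) (map_mx f F3).
Proof. by rewrite /blk !map_row_mx. Qed.

Lemma map_koszul m n (F1 F2 F3 : 'M[R]_(m, n)) :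
  map_mx f (koszul F1 F2 F3) = koszul (map_mx f F1) (map_mx f F2) (map_mx f F3).
Proof. by rewrite /koszul !map_col_mx !map_blk !map_mxN !map_mx0. Qed.

End MapMul.

(* [D ; E] and [X | Z] as square matrices; the product [D ; E][X | Z] is block
   triangular when D Z = 0. *)
Section SquareBlocks.

Variables (R : comNzRingType) (a c N : nat) (h : (a + c)%N = N).

Definition stack (D : 'M[R]_(a, N)) (E : 'M[R]_(c, N)) : 'M_N :=
  castmx (h, erefl N) (col_mx D E).

Definition juxt (X : 'M[R]_(N, a)) (Z : 'M[R]_(N, c)) : 'M_N :=
  castmx (erefl N, h) (row_mx X Z).

Lemma det_stack_juxt D E X Z : D *m Z = 0 ->
  \det (stack D E) * \det (juxt X Z) = \det (D *m X) * \det (E *m Z).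
Proof.
rewrite /stack /juxt; case: N / h D E X Z => D E X Z DZ0.
by rewrite !castmx_id -det_mulmx mul_col_row DZ0 det_lblock.
Qed.

Lemma det_stack_juxt' D E X Z : E *m X = 0 ->
  \det (stack D E) * \det (juxt X Z) = \det (D *m X) * \det (E *m Z).
Proof.
rewrite /stack /juxt; case: N / h D E X Z => D E X Z DZ0.
by rewrite !castmx_id -det_mulmx mul_col_row DZ0 det_ublock.
Qed.

End SquareBlocks.

Lemma map_stack (R S : comNzRingType) (f : {rmorphism R -> S}) a c N
    (h : (a + c)%N = N) (D : 'M[R]_(a, N)) (E : 'M[R]_(c, N)) :
  map_mx f (stack h D E) = stack h (map_mx f D) (map_mx f E).
Proof. by rewrite /stack map_castmx map_col_mx. Qed.

Lemma map_juxt (R S : comNzRingType) (f : {rmorphism R -> S}) a c N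
    (h : (a + c)%N = N) (X : 'M[R]_(N, a)) (Z : 'M[R]_(N, c)) :
  map_mx f (juxt h X Z) = juxt h (map_mx f X) (map_mx f Z).
Proof. by rewrite /juxt map_castmx map_row_mx. Qed.

Section ResAt.

Variable n : nat.
Local Notation A := {mpoly int[#|coef_idx 3 n|]}.

Lemma res_atM (T : comNzRingType) (P Q : A) (c : 'I_3 -> idx n -> T) :
  res_at (P * Q) c = res_at P c * res_at Q c.
Proof. exact: rmorphM. Qed.

Lemma res_atXn (T : comNzRingType) (P : A) k (c : 'I_3 -> idx n -> T) :
  res_at (P ^+ k) c = res_at P c ^+ k.
Proof. exact: rmorphXn. Qed.

Lemma res_at_morph (T U : comNzRingType) (f : {rmorphism T -> U}) (P : A)
    (c : 'I_3 -> idx n -> T) :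
  f (res_at P c) = res_at P (fun i p => f (c i p)).
Proof.
rewrite /res_at /mmap rmorph_sum; apply: eq_bigr => m _.
rewrite rmorphM /= rmorph_int; congr (_ * _).
by rewrite /mmap1 rmorph_prod; apply: eq_bigr => i _; rewrite rmorphXn.
Qed.

Definition generic (i : 'I_3) (p : idx n) : A := 'X_(enum_rank ((i, p) : coef_idx 3 n)).

Lemma res_at_generic (P : A) : res_at P generic = P.
Proof.
rewrite [RHS]mpolyE /res_at /mmap; apply: eq_bigr => m _.
rewrite -mul_mpolyC; congr (_ * _).
  rewrite -[in RHS](intz P@_m); exact/esym/rmorph_int.
rewrite mpolyXE_id /mmap1; apply: eq_bigr => i _.
by rewrite /generic -surjective_pairing enum_valK.
Qed.

End ResAt.

Lemma mon_le l (p : idx l) i : (mon p i <= l)%N.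
Proof. by have := mdeg_mon p; rewrite mdegE (bigD1 i) //=; lia. Qed.

Section MonomialMul.

Variable R : comNzRingType.

Lemma Mul_mon l l' (m : 'X_{1..3}) r c :
  Mul (R := R) l l' 'X_[m] r c = (mon (enum_val c) + m == mon (enum_val r))%MM%:R.
Proof. by rewrite mxE -mpolyXD mcoeffX. Qed.

Lemma sum_mon_eq l (m1 m2 : 'X_{1..3}) : mdeg m1 = l ->
  \sum_(r < #|idx l|) (m1 == mon (enum_val r))%:R * (m2 == mon (enum_val r))%:R
    = (m1 == m2)%:R :> R.
Proof.
move=> /mon_surj[p <-]; rewrite (bigD1 (enum_rank p)) //= enum_rankK eqxx mul1r.
rewrite big1 ?addr0; first by rewrite eq_sym.
move=> i ip; rewrite (inj_eq (@mon_inj l)) -[p == _](inj_eq enum_rank_inj) enum_valK.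
by rewrite eq_sym (negPf ip) mul0r.
Qed.

Lemma tr_Mul_mon l l' (m1 m2 : 'X_{1..3}) c1 c2 : (l + mdeg m1)%N = l' ->
  ((Mul l l' 'X_[m1])^T *m Mul l l' 'X_[m2] : 'M[R]_#|idx l|) c1 c2
    = (mon (enum_val c1) + m1 == mon (enum_val c2) + m2)%MM%:R.
Proof.
move=> e; rewrite mxE -(@sum_mon_eq l'); last by rewrite mdegD mdeg_mon.
by apply: eq_bigr => i _; rewrite [X in X * _]mxE !Mul_mon.
Qed.

Lemma tr_Mul_mon1 l l' (m : 'X_{1..3}) : (l + mdeg m)%N = l' ->
  (Mul l l' 'X_[m])^T *m Mul l l' 'X_[m] = 1%:M :> 'M[R]_#|idx l|.
Proof.
move=> e; apply/matrixP => i j; rewrite tr_Mul_mon // mxE.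
by rewrite eqm_add2r (inj_eq (@mon_inj l)) (inj_eq enum_val_inj).
Qed.

(** Multiplication by X^m sends distinct monomials to distinct monomials, so its transpose divides
    by X^m and sends the other monomials to 0; the product is the projection onto the multiples of
    X^m. *)
Lemma Mul_mon_tr l l' (m : 'X_{1..3}) : (l + mdeg m)%N = l' ->
  Mul l l' 'X_[m] *m (Mul l l' 'X_[m])^T
    = diag_mx (\row_r (m <= mon (enum_val r))%MM%:R) :> 'M[R]_#|idx l'|.
Proof.
move=> e; apply/matrixP => i j; rewrite mxE [RHS]mxE [in RHS]mxE.
under eq_bigr do rewrite [X in _ * X]mxE !Mul_mon.
have [lem|nlem] := boolP (m <= mon (enum_val i))%MM; last first.
  rewrite mul0rn big1 // => k _; case: eqP => [ek|_]; last by rewrite mul0r.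
  by case/negP: nlem; rewrite -ek lem_addl.
set mi := mon (enum_val i) in lem *; set mj := mon _.
transitivity (\sum_(k < #|idx l|) ((mi - m)%MM == mon (enum_val k))%:R *
   ((m <= mj)%MM && ((mj - m)%MM == mon (enum_val k)))%:R : R).
  apply: eq_bigr => k _; rewrite -[in LHS](submK lem) eqm_add2r eq_sym; congr (_ * _%:R).
  have [lemj|nlemj] := boolP (m <= mj)%MM; first by rewrite -{1}(submK lemj) eqm_add2r eq_sym.
  by rewrite /=; case: eqP => // ek; case/negP: nlemj; rewrite -ek lem_addl.
have [lemj|nlemj] /= := boolP (m <= mj)%MM; last first.
  rewrite big1 => [|k _]; last by rewrite mulr0.
  by case: eqP => // eij; case/negP: nlemj; rewrite /mj -eij.
rewrite sum_mon_eq; last first.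
  by apply/(@addIn (mdeg m)); rewrite -mdegD submK // mdeg_mon e.
rewrite -[(_ - _)%MM == _](eqm_add2r m) !submK // (inj_eq (@mon_inj l')).
by rewrite (inj_eq enum_val_inj) mulr1n; case: eqP.
Qed.

End MonomialMul.

(** * Splitting of the Koszul complex, modelled on the pure powers *)

Section AbstractKoszul.

Variables (R : comNzRingType) (w q a : nat).
Variables (P0 P1 P2 : 'M[R]_(q, w)) (Q0 Q1 Q2 : 'M[R]_(a, q)).

Lemma blk_scalar_mx m (k0 k1 k2 : R) :
  col_mx (blk k0%:M 0 0) (col_mx (blk 0 k1%:M 0) (blk 0 0 k2%:M))
    = block_mx k0%:M 0 0 (block_mx k1%:M 0 0 k2%:M) :> 'M_(m + (m + m)).
Proof.
rewrite /blk row_mx0 [RHS]block_mxEv; congr col_mx.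
by rewrite -col_mx0 -block_mxEh block_mxEv.
Qed.

(* retract0 is a left inverse of the Koszul map of (P0, P1, P2) that kills
   section0, a right inverse of blk Q0 Q1 Q2. retract1 is chosen so that on
   multiples k_i P_i only the differences k_j - k_i occur, which makes its minor
   a nonzero constant for k_i = i + 'X. *)
Definition retract0 : 'M[R]_(w + (w + w), q + (q + q)) :=
  col_mx (blk 0 (- P0^T) 0) (col_mx (blk 0 0 (- P0^T)) (blk 0 0 (- P1^T))).

Definition retract1 : 'M[R]_(w + (w + w), q + (q + q)) :=
  col_mx (blk P1^T P0^T 0) (col_mx (blk P2^T 0 P0^T) (blk 0 P2^T P1^T)).

(** For the pure powers, a monomial is divided by the first of s^n, t^n, u^n that divides it: the
    factors 1 - Q_i Q_i^T discard the monomials served by an earlier power. *)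
Definition section0 : 'M[R]_(q + (q + q), a) :=
  col_mx Q0^T (col_mx (Q1^T *m (1%:M - Q0 *m Q0^T))
    (Q2^T *m ((1%:M - Q1 *m Q1^T) *m (1%:M - Q0 *m Q0^T)))).

Hypotheses (P00 : P0^T *m P0 = 1%:M) (P11 : P1^T *m P1 = 1%:M).
Hypotheses (P22 : P2^T *m P2 = 1%:M).
Hypotheses (P01 : P0^T *m P1 = 0) (P10 : P1^T *m P0 = 0).
Hypotheses (P02 : P0^T *m P2 = 0) (P20 : P2^T *m P0 = 0).
Hypotheses (P12 : P1^T *m P2 = 0) (P21 : P2^T *m P1 = 0).

Lemma retract0_koszul : retract0 *m koszul P0 P1 P2 = 1%:M.
Proof.
rewrite /retract0 /koszul !mul_col_mx !blk_mul !mul_blk !blkD !mul0mx !mulmx0.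
rewrite !mulNmx !mulmxN !opprK P00 P11 P10 P01 P02 !oppr0 !addr0 !add0r.
by rewrite blk_scalar_mx -!scalar_mx_block.
Qed.

Lemma retract1_koszul (k0 k1 k2 : R) :
  retract1 *m koszul (k0 *: P0) (k1 *: P1) (k2 *: P2) =
    block_mx (k1 - k0)%:M 0 0 (block_mx (k2 - k0)%:M 0 0 (k2 - k1)%:M).
Proof.
rewrite /retract1 /koszul !mul_col_mx !blk_mul !mul_blk !blkD !mul0mx !mulmx0.
rewrite !mulmxN -!scalemxAr P00 P11 P22 P10 P01 P20 P02 P12 P21.
rewrite !scaler0 !oppr0 !addr0 !add0r -blk_scalar_mx !scalemx1 -!raddfN -!raddfD /=.
by [].
Qed.

Hypotheses (QP01 : Q0 *m P1 = Q1 *m P0) (QP02 : Q0 *m P2 = Q2 *m P0).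
Hypotheses (QP12 : Q1 *m P2 = Q2 *m P1).
Hypotheses (Q00 : Q0^T *m Q0 = 1%:M) (Q11 : Q1^T *m Q1 = 1%:M).
Local Notation Pi0 := (Q0 *m Q0^T).
Local Notation Pi1 := (Q1 *m Q1^T).
Local Notation Pi2 := (Q2 *m Q2^T).
Hypothesis Pi_comm : Pi0 *m Pi1 = Pi1 *m Pi0.
Hypothesis cover : (1%:M - Pi2) *m ((1%:M - Pi1) *m (1%:M - Pi0)) = 0.

Lemma blk_section0 : blk Q0 Q1 Q2 *m section0 = 1%:M.
Proof.
have fix2 : Pi2 *m ((1%:M - Pi1) *m (1%:M - Pi0)) = (1%:M - Pi1) *m (1%:M - Pi0).
  by apply/eqP; rewrite eq_sym -subr_eq0 -{1}[_ *m _]mul1mx -mulmxBl cover.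
rewrite /section0 blk_mul !(mulmxA _ _^T) fix2 -mulmxDl.
by rewrite [Pi1 + _]addrC subrK mul1mx addrC subrK.
Qed.

(** Transposing Q_i P_j = Q_j P_i lets each entry be rewritten so that some Q_i^T meets 1 - Q_i
    Q_i^T, which it annihilates; [Pi_comm] brings the two together where needed. *)
Lemma retract0_section0 : retract0 *m section0 = 0.
Proof.
have tr01 : P0^T *m Q1^T = P1^T *m Q0^T by rewrite -!trmx_mul QP01.
have tr02 : P0^T *m Q2^T = P2^T *m Q0^T by rewrite -!trmx_mul QP02.
have tr12 : P1^T *m Q2^T = P2^T *m Q1^T by rewrite -!trmx_mul QP12.
have kill0 : Q0^T *m (1%:M - Pi0) = 0 by rewrite mulmxBr mulmx1 mulmxA Q00 mul1mx subrr.
have kill1 : Q1^T *m (1%:M - Pi1) = 0 by rewrite mulmxBr mulmx1 mulmxA Q11 mul1mx subrr.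
have comm : (1%:M - Pi1) *m (1%:M - Pi0) = (1%:M - Pi0) *m (1%:M - Pi1).
  rewrite !mulmxBr !mulmxBl !mulmx1 !mul1mx Pi_comm !opprB.
  by rewrite addrACA [RHS]addrACA; congr (_ + _); rewrite addrC.
rewrite /retract0 /section0 !mul_col_mx !blk_mul !mul0mx !add0r !addr0 !mulNmx.
rewrite !mulmxA tr01 tr02 tr12 -!mulmxA kill0 mulmx0.
rewrite [Q1^T *m _]mulmxA kill1 mul0mx mulmx0 comm [Q0^T *m _]mulmxA kill0.
by rewrite mul0mx mulmx0 !oppr0 !col_mx0.
Qed.

End AbstractKoszul.

Lemma det_pencilr (R : comNzRingType) k m (E : 'M[R]_(k, m)) (Z Z1 : 'M_(m, k)) :
  E *m Z1 = 1%:M ->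
  \det (map_mx polyC E *m (map_mx polyC Z + 'X *: map_mx polyC Z1))
    = char_poly (- (E *m Z)).
Proof.
move=> EZ1; rewrite mulmxDr -scalemxAr -!map_mxM EZ1 /char_poly /char_poly_mx.
by rewrite map_mxN opprK map_mx1 scalemx1 addrC.
Qed.

Lemma det_pencill (R : comNzRingType) k m (X : 'M[R]_(m, k)) (D D1 : 'M_(k, m)) :
  D1 *m X = 1%:M ->
  \det ((map_mx polyC D + 'X *: map_mx polyC D1) *m map_mx polyC X)
    = char_poly (- (D *m X)).
Proof.
move=> D1X; rewrite mulmxDl -scalemxAl -!map_mxM D1X /char_poly /char_poly_mx.
by rewrite map_mxN opprK map_mx1 scalemx1 addrC.
Qed.

(** * The Koszul complex of three ternary forms in degree 3n - 1 *)

Section Koszul.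

Variable n : nat.
Hypothesis n_gt0 : (0 < n)%N.

Local Notation l1 := n.-1.
Local Notation l2 := (2 * n).-1.
Local Notation l3 := (3 * n).-1.
Local Notation w := #|idx l1|.
Local Notation q := #|idx l2|.
Local Notation a := #|idx l3|.
Local Notation N := (q + (q + q))%N.
Local Notation W := (w + (w + w))%N.
Local Notation i0 := (ord0 : 'I_3).
Local Notation i1 := (lift ord0 ord0 : 'I_3).
Local Notation i2 := (ord_max : 'I_3).

Lemma l12 : (l1 + n)%N = l2. Proof. by lia. Qed.
Lemma l23 : (l2 + n)%N = l3. Proof. by lia. Qed.

(** The Euler characteristic of the complex vanishes; this is what makes [stack] and [juxt]
    square. *)
Lemma koszul_dim : (a + W)%N = N.
Proof.
have := card_idx_pred n_gt0; have := @card_idx_pred (2 * n).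
by have := @card_idx_pred (3 * n); lia.
Qed.

Section Ring.

Variable R : comNzRingType.
Implicit Types c : 'I_3 -> idx n -> R.

Definition Dmx c : 'M[R]_(a, N) :=
  blk (Mul l2 l3 (form (c i0))) (Mul l2 l3 (form (c i1))) (Mul l2 l3 (form (c i2))).

Definition Zmx c : 'M[R]_(N, W) :=
  koszul (Mul l1 l2 (form (c i0))) (Mul l1 l2 (form (c i1)))
         (Mul l1 l2 (form (c i2))).

Lemma DZ0 c : Dmx c *m Zmx c = 0.
Proof.
rewrite /Dmx /Zmx /koszul blk_mul !mul_blk !blkD !mulmxN !mulmx0 !addr0 !add0r.
have C i j := Mul_comm l3 (form_homog (c i)) (form_homog (c j)) l12.
by rewrite (C i1 i0) (C i2 i0) (C i2 i1) !subrr /blk !row_mx0.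
Qed.

Definition pure (i : 'I_3) : 'X_{1..3} := (U_(i) *+ n)%MM.

Definition pure_coef (i : 'I_3) (p : idx n) : R := (mon p == pure i)%:R.

Lemma mdeg_pure i : mdeg (pure i) = n.
Proof. by rewrite mdegMn mdeg1 mul1n. Qed.

Lemma form_pure (k : R) i :
  form (fun p => k * pure_coef i p) = k *: 'X_[pure i].
Proof.
apply/mpolyP => m; rewrite mcoeffZ mcoeffX /form raddf_sum /=.
have [p ep] := mon_surj (mdeg_pure i).
rewrite (bigD1 p) //= mcoeffZ mcoeffX /pure_coef ep eqxx mulr1 big1 ?addr0 //.
move=> p' np; rewrite -ep (inj_eq (@mon_inj n)) mcoeffZ mcoeffX.
by rewrite (negPf np) mulr0 mul0r.
Qed.

Lemma pureE i j : pure i j = if i == j then n else 0%N.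
Proof. by rewrite mulmnE mnm1E; case: eqP; rewrite ?mul1n. Qed.

Local Notation P i := (Mul (R := R) l1 l2 'X_[pure i]).
Local Notation Q i := (Mul (R := R) l2 l3 'X_[pure i]).
Local Notation Pi i := (Q i *m (Q i)^T).

Lemma trPP i : (P i)^T *m P i = 1%:M.
Proof. by apply: tr_Mul_mon1; rewrite mdeg_pure l12. Qed.

(** Two pure powers never meet in degree 2n - 1: a monomial of degree n - 1 has no exponent as large
    as n. *)
Lemma trPP0 i j : i != j -> (P i)^T *m P j = 0.
Proof.
move=> ij; apply/matrixP => r c; rewrite tr_Mul_mon ?mdeg_pure ?l12 // mxE.
case: eqP => // /mnmP/(_ i); rewrite !mnmDE !pureE eqxx eq_sym (negPf ij) addn0.
by move=> e; have := mon_le (enum_val c) i; rewrite -e; lia.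
Qed.

Lemma trQQ i : (Q i)^T *m Q i = 1%:M.
Proof. by apply: tr_Mul_mon1; rewrite mdeg_pure l23. Qed.

Lemma QP i j : Q i *m P j = Q j *m P i.
Proof. by apply: (@Mul_comm _ _ _ _ n) => //; rewrite ?l12 // dhomogX; apply/eqP/mdeg_pure. Qed.

Lemma PiE i : Pi i = diag_mx (\row_r (n <= mon (enum_val r) i)%:R).
Proof.
rewrite Mul_mon_tr ?mdeg_pure ?l23 //; congr diag_mx; apply/rowP => r.
rewrite !mxE; congr (_%:R); congr nat_of_bool; apply/mnm_lepP/idP => [/(_ i)|h j].
  by rewrite pureE eqxx.
by rewrite pureE; case: eqP => [<-|].
Qed.

Lemma Pi_comm i j : Pi i *m Pi j = Pi j *m Pi i.
Proof. by rewrite !PiE diag_mxC. Qed.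

(** A monomial of degree 3n - 1 > 3(n - 1) has an exponent of at least n. *)
Lemma Pi_cover : (1%:M - Pi i2) *m ((1%:M - Pi i1) *m (1%:M - Pi i0)) = 0.
Proof.
rewrite !PiE -!diag_const_mx -!raddfB /= !mulmx_diag; apply/matrixP => r c.
rewrite !mxE; case: eqP => // _; rewrite mulr1n.
have := mdeg_mon (enum_val r); rewrite mdeg3.
case: (leqP n (mon _ i0)) => h0; case: (leqP n (mon _ i1)) => h1;
  case: (leqP n (mon _ i2)) => h2; rewrite ?subrr ?mul0r ?mulr0 //; lia.
Qed.

Lemma Zmx_pure (k : 'I_3 -> R) :
  Zmx (fun i p => k i * pure_coef i p) = koszul (k i0 *: P i0) (k i1 *: P i1) (k i2 *: P i2).
Proof. by rewrite /Zmx !form_pure !MulZ. Qed.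

Definition E0mx : 'M[R]_(W, N) := retract0 (P i0) (P i1).
Definition E1mx : 'M[R]_(W, N) := retract1 (P i0) (P i1) (P i2).
Definition X0mx : 'M[R]_(N, a) := section0 (Q i0) (Q i1) (Q i2).

Lemma pure_coef1 i : form (fun p => pure_coef i p) = 'X_[pure i].
Proof.
rewrite -[RHS]scale1r -form_pure; apply: eq_bigr => p _.
by rewrite mul1r.
Qed.

Lemma E0Z_pure : E0mx *m Zmx pure_coef = 1%:M.
Proof. by rewrite /Zmx !pure_coef1; apply: retract0_koszul; rewrite ?trPP ?trPP0. Qed.

Lemma DX0_pure : Dmx pure_coef *m X0mx = 1%:M.
Proof. by rewrite /Dmx !pure_coef1; apply: blk_section0; apply: Pi_cover. Qed.

Lemma E0X0 : E0mx *m X0mx = 0.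
Proof.
apply: (@retract0_section0 _ _ _ _ (P i0) (P i1) (P i2)); rewrite ?trQQ //.
- exact: QP.
- exact: QP.
- exact: QP.
- exact: Pi_comm.
Qed.

Lemma E1Z_pure (k : 'I_3 -> R) :
  E1mx *m Zmx (fun i p => k i * pure_coef i p) =
    block_mx (k i1 - k i0)%:M 0 0 (block_mx (k i2 - k i0)%:M 0 0 (k i2 - k i1)%:M).
Proof. by rewrite Zmx_pure; apply: retract1_koszul; rewrite ?trPP ?trPP0. Qed.

Lemma formD l (c d : idx l -> R) : form (fun p => c p + d p) = form c + form d.
Proof. by rewrite /form -big_split; apply: eq_bigr => p _; rewrite scalerDl. Qed.

Lemma formZ l k (c : idx l -> R) : form (fun p => k * c p) = k *: form c.
Proof. by rewrite /form scaler_sumr; apply: eq_bigr => p _; rewrite scalerA. Qed.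

Lemma DmxDZ c k d : Dmx (fun i p => c i p + k * d i p) = Dmx c + k *: Dmx d.
Proof. by rewrite /Dmx !formD !formZ !MulD !MulZ blkZ blkD. Qed.

Lemma ZmxDZ c k d : Zmx (fun i p => c i p + k * d i p) = Zmx c + k *: Zmx d.
Proof. by rewrite /Zmx !formD !formZ !MulD !MulZ koszulZ koszulD. Qed.

(* full0 / minor0 is the determinant of the Koszul complex in degree 3n - 1. *)
Definition minor0 c : R := \det (E0mx *m Zmx c).
Definition minor1 c : R := \det (E1mx *m Zmx c).
Definition full0 c : R := \det (stack koszul_dim (Dmx c) E0mx).
Definition full1 c : R := \det (stack koszul_dim (Dmx c) E1mx).

Lemma minor1_pure (k : 'I_3 -> R) :
  minor1 (fun i p => k i * pure_coef i p)
    = (k i1 - k i0) ^+ w * ((k i2 - k i0) ^+ w * (k i2 - k i1) ^+ w).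
Proof. by rewrite /minor1 E1Z_pure !det_ublock !det_scalar. Qed.

End Ring.

Section Morph.

Variables (R S : comNzRingType) (f : {rmorphism R -> S}).
Implicit Types c : 'I_3 -> idx n -> R.

Lemma map_Dmx c : map_mx f (Dmx c) = Dmx (fun i p => f (c i p)).
Proof. by rewrite /Dmx map_blk !map_Mul !map_form. Qed.

Lemma map_Zmx c : map_mx f (Zmx c) = Zmx (fun i p => f (c i p)).
Proof. by rewrite /Zmx map_koszul !map_Mul !map_form. Qed.

Lemma map_Mul_mon l l' m : map_mx f (Mul l l' 'X_[m]) = Mul l l' 'X_[m].
Proof. by rewrite map_Mul map_mpolyX. Qed.

Lemma map_E0mx : map_mx f (E0mx R) = E0mx S.
Proof.
by rewrite /E0mx /retract0 !map_col_mx !map_blk !map_mxN -!map_trmx !map_Mul_mon !map_mx0.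
Qed.

Lemma map_E1mx : map_mx f (E1mx R) = E1mx S.
Proof.
by rewrite /E1mx /retract1 !map_col_mx !map_blk -!map_trmx !map_Mul_mon !map_mx0.
Qed.

Lemma map_X0mx : map_mx f (X0mx R) = X0mx S.
Proof.
rewrite /X0mx /section0 !map_col_mx !map_mxM !map_mxB !map_mxM -!map_trmx !map_mx1.
by rewrite !map_Mul_mon.
Qed.

Lemma minor0_morph c : f (minor0 c) = minor0 (fun i p => f (c i p)).
Proof. by rewrite /minor0 -det_map_mx map_mxM map_E0mx map_Zmx. Qed.

Lemma minor1_morph c : f (minor1 c) = minor1 (fun i p => f (c i p)).
Proof. by rewrite /minor1 -det_map_mx map_mxM map_E1mx map_Zmx. Qed.

Lemma full0_morph c : f (full0 c) = full0 (fun i p => f (c i p)).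
Proof. by rewrite /full0 -det_map_mx map_stack map_E0mx map_Dmx. Qed.

End Morph.

Section Shift.

Variable R : comNzRingType.
Implicit Types c : 'I_3 -> idx n -> R.

(* Adding 'X (s^n, t^n, u^n) turns the minors into characteristic polynomials. *)
Definition shift c (i : 'I_3) (p : idx n) : {poly R} :=
  (c i p)%:P + 'X * pure_coef {poly R} i p.

Lemma shift_horner0 c i p : (shift c i p).[0] = c i p.
Proof. by rewrite /shift hornerD hornerM hornerX mul0r addr0 hornerC. Qed.

Lemma Zmx_shift c :
  Zmx (shift c) = map_mx polyC (Zmx c) + 'X *: map_mx polyC (Zmx (@pure_coef R)).
Proof.
rewrite ZmxDZ !map_Zmx; congr (_ + _ *: Zmx _); do 2!apply: functional_extensionality=> ?.
by rewrite /pure_coef rmorph_nat.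
Qed.

Lemma Dmx_shift c :
  Dmx (shift c) = map_mx polyC (Dmx c) + 'X *: map_mx polyC (Dmx (@pure_coef R)).
Proof.
rewrite DmxDZ !map_Dmx; congr (_ + _ *: Dmx _); do 2!apply: functional_extensionality=> ?.
by rewrite /pure_coef rmorph_nat.
Qed.

Lemma minor0_shift c : minor0 (shift c) = char_poly (- (E0mx R *m Zmx c)).
Proof.
rewrite /minor0 Zmx_shift -(map_E0mx polyC); apply: det_pencilr.
exact: E0Z_pure.
Qed.

Lemma DX0_shift c : \det (Dmx (shift c) *m X0mx _) = char_poly (- (Dmx c *m X0mx R)).
Proof.
rewrite Dmx_shift -(map_X0mx polyC); apply: det_pencill.
exact: DX0_pure.
Qed.

(** [E0mx] kills [X0mx], which makes the block product triangular although [Zmx] is taken at the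
    pure powers and not at the shifted forms. The extra determinant does not involve c, and
    [res_shift] shows that it is a unit. *)
Lemma full0_shift c :
  full0 (shift c) * \det (juxt koszul_dim (X0mx _) (Zmx (@pure_coef _)))
    = char_poly (- (Dmx c *m X0mx R)).
Proof.
by rewrite /full0 det_stack_juxt' ?E0X0 // E0Z_pure det1 mulr1 DX0_shift.
Qed.

(** Both sides are [minor0 c * minor1 c] times the determinant of [Dmx c *m X0mx]: full over minor
    does not depend on the chosen rows. The common factor stays because it may vanish at c; after
    the shift it is nonzero. *)
Lemma full_minor c : full0 c * minor1 c * \det (juxt koszul_dim (X0mx _) (Zmx c)) =
  full1 c * minor0 c * \det (juxt koszul_dim (X0mx _) (Zmx c)).
Proof.
rewrite mulrAC (det_stack_juxt _ _ _ (DZ0 c)) -/(minor0 c).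
by rewrite [RHS]mulrAC (det_stack_juxt _ _ _ (DZ0 c)) -/(minor1 c) mulrAC.
Qed.

End Shift.

End Koszul.

(** * The determinant of the Koszul complex as a polynomial *)

Lemma coprime_divides (B : idomainType) (x y z : B) : factorial_ring B -> x != 0 ->
    (forall p, prime_elt p -> divides p x -> ~ divides p y) ->
  divides x (z * y) -> divides x z.
Proof.
move=> fB x0; have [u [s [uu ps ->]]] := fB x x0.
move=> cop [c e]; suff [d ed] : divides (\prod_(p <- s) p) z.
  by exists (d / u); rewrite ed mulrA divrK.
have {c e} : exists c, z * y = c * \prod_(p <- s) p by exists (c * u); rewrite e mulrA.
have {cop} : forall p, p \in s -> ~ divides p y.
  move=> p sp; apply: cop; first exact: ps.
  by rewrite (perm_big _ (perm_to_rem sp)) big_cons mulrCA; exists (u * \prod_(j <- rem p s) j); rewrite mulrC.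
elim: s z ps => [|p s IH] z ps cop [c e].
  by exists z; rewrite big_nil mulr1.
have pp : prime_elt p by apply: ps; rewrite mem_head.
have [p0 _ pP] := pp.
have [|[d ed]|/cop] := pP z y; last by rewrite mem_head => /(_ isT).
  by rewrite e big_cons mulrCA; exists (c * \prod_(j <- s) j); rewrite mulrC.
have [||| d' ed'] := IH d.
- by move=> q qs; apply: ps; rewrite inE qs orbT.
- by move=> q qs; apply: cop; rewrite inE qs orbT.
- exists c; apply: (mulIf p0); rewrite -mulrA [_ * p]mulrC [p * y]mulrC.
  by move: e; rewrite ed big_cons => e; rewrite -mulrA [_ * p]mulrC -e; ring.
by exists d'; rewrite ed ed' big_cons; ring.
Qed.

Section Resultant.

Variable n : nat.
Hypothesis n_gt0 : (0 < n)%N.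

Local Notation A := {mpoly int[#|coef_idx 3 n|]}.
Local Notation g := (@generic n).
Local Notation w := #|idx n.-1|.
Local Notation q := #|idx (2 * n).-1|.
Local Notation a := #|idx (3 * n).-1|.
Local Notation N := (q + (q + q))%N.

(** Shifted, these forms are 'X s^n, (1 + 'X) t^n, (2 + 'X) u^n. The differences of the multipliers
    are the constants 1, 2, 1, which is where the power of 2 below comes from; it is nonzero in
    [rat]. *)
Definition spec_coef (i : 'I_3) (p : idx n) : rat := (i : nat)%:R * pure_coef rat i p.

Lemma minor1_spec : minor1 (shift spec_coef) = (2 ^+ w)%:P.
Proof.
pose k (i : 'I_3) : {poly rat} := (i : nat)%:R + 'X.
have -> : shift spec_coef = (fun i p => k i * pure_coef {poly rat} i p).
  do 2!apply: functional_extensionality => ?.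
  by rewrite /shift /spec_coef /pure_coef polyCM !polyC_natr mulrDl.
have k10 : k (lift ord0 ord0) - k ord0 = 1 by rewrite -[LHS]/(1%:R + 'X - (0%:R + 'X)); ring.
have k20 : k ord_max - k ord0 = 2 by rewrite -[LHS]/(2%:R + 'X - (0%:R + 'X)); ring.
have k21 : k ord_max - k (lift ord0 ord0) = 1 by rewrite -[LHS]/(2%:R + 'X - (1%:R + 'X)); ring.
by rewrite (minor1_pure n_gt0 k) k10 k20 k21 !expr1n mulr1 mul1r polyC_exp polyC_natr.
Qed.

(** It is a factor of a product of two characteristic polynomials, hence of a monic polynomial. *)
Lemma juxt_shift_neq0 (R : idomainType) (c : 'I_3 -> idx n -> R) :
  \det (juxt (koszul_dim n_gt0) (X0mx n _) (Zmx (shift c))) != 0.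
Proof.
have := det_stack_juxt (koszul_dim n_gt0) (E0mx n _) (X0mx n _) (DZ0 n_gt0 (shift c)).
rewrite DX0_shift // -/(minor0 (shift c)) minor0_shift // => e.
have : char_poly (- (Dmx c *m X0mx n R)) * char_poly (- (E0mx n R *m Zmx c)) != 0.
  by rewrite mulf_neq0 // monic_neq0 // char_poly_monic.
by rewrite -e mulf_eq0 negb_or => /andP[].
Qed.

(* minor0 and minor1 of the shifted forms have no common prime factor: a factor
   of the monic minor0 keeps its degree under specialization, and minor1
   specializes to a nonzero constant. *)
Lemma minor0_dvd_full0 :
  divides (minor0 (shift g)) (full0 n_gt0 (shift g)).
Proof.
have m0 : minor0 (shift g) \is monic by rewrite minor0_shift // char_poly_monic.
apply: (@coprime_divides _ _ (minor1 (shift g))).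
- exact/factorial_poly/factorial_mpoly_int.
- exact: monic_neq0.
- move=> p [p0 pu _] [c ec] [d ed]; case/negP: pu.
  pose sg : {rmorphism A -> rat} := mmap intr (fun v => spec_coef (enum_val v).1 (enum_val v).2).
  have sgg i r : sg (g i r) = spec_coef i r by rewrite /sg /= mmapX mmap1U enum_rankK.
  have lp : lead_coef c * lead_coef p = 1.
    by rewrite -lead_coefM -ec; apply/eqP.
  have ulp : lead_coef p \is a GRing.unit.
    by apply/unitrPr; exists (lead_coef c); rewrite mulrC.
  have sp : size (map_poly sg p) = size p.
    by rewrite size_map_poly_id0 // -unitfE rmorph_unit.
  have e2 : map_poly sg d * map_poly sg p = (2 ^+ w)%:P.
    rewrite -rmorphM -ed minor1_morph -minor1_spec; congr minor1.
    do 2!apply: functional_extensionality => ?; rewrite /shift rmorphD rmorphM /=.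
    by rewrite map_polyC map_polyX /= sgg /pure_coef rmorph_nat.
  have ne : map_poly sg d * map_poly sg p != 0.
    by rewrite e2 polyC_eq0 expf_neq0.
  move: ne; rewrite mulf_eq0 negb_or => /andP[nd np].
  have : size (map_poly sg d * map_poly sg p) = 1%N.
    by rewrite e2 size_polyC expf_neq0.
  rewrite size_mul // sp => e1.
  have p1 : (size p <= 1)%N by move: e1; rewrite -size_poly_gt0 in nd; lia.
  move: ulp; rewrite (size1_polyC p1) lead_coefC => ulp.
  exact: rmorph_unit.
have /mulIf := juxt_shift_neq0 g.
move=> /(_ _ _ (full_minor n_gt0 (shift g))) ->.
by exists (full1 n_gt0 (shift g)).
Qed.

(* Put 'X = 0 in the divisibility of the shifted determinants. *)
Lemma exists_resultant : exists K : A, full0 n_gt0 g = K * minor0 g.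
Proof.
have [k ek] := minor0_dvd_full0; exists k.[0].
have e0 : horner_eval 0 (full0 n_gt0 (shift g)) = horner_eval 0 (k * minor0 (shift g)).
  by rewrite ek.
rewrite full0_morph rmorphM minor0_morph in e0.
have eg : (fun i p => horner_eval 0 (shift g i p)) = g.
  by do 2!apply: functional_extensionality => ?; rewrite /horner_eval shift_horner0.
by rewrite eg in e0.
Qed.

End Resultant.

(** * The determinant identity over any ring, and the degree of K along the pencil *)

Section Universal.

Variable n : nat.
Hypothesis n_gt0 : (0 < n)%N.

Local Notation A := {mpoly int[#|coef_idx 3 n|]}.
Local Notation g := (@generic n).
Local Notation q := #|idx (2 * n).-1|.
Local Notation a := #|idx (3 * n).-1|.
Local Notation N := (q + (q + q))%N.

Variable K : A.
Hypothesis KP : full0 n_gt0 g = K * minor0 g.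

Lemma res_at_full (R : comNzRingType) (c : 'I_3 -> idx n -> R) :
  full0 n_gt0 c = res_at K c * minor0 c.
Proof.
pose f : {rmorphism A -> R} := mmap intr (fun v => c (enum_val v).1 (enum_val v).2).
have fg : (fun i p => f (g i p)) = c.
  do 2!apply: functional_extensionality => ?.
  by rewrite /f /= mmapX mmap1U enum_rankK.
have := congr1 f KP; rewrite rmorphM full0_morph minor0_morph fg => ->; congr (_ * _).
Qed.

(** The minor may be a zero divisor at c. Along the shifted forms it is monic, hence regular, while
    X is kept constant; the identity is proved there and evaluated at 'X = 0. *)
Lemma res_at_det (R : comNzRingType) (c : 'I_3 -> idx n -> R) (X : 'M_(N, a)) :
  res_at K c * \det (juxt (koszul_dim n_gt0) X (Zmx c)) = \det (Dmx c *m X).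
Proof.
pose X' : 'M[{poly R}]_(N, a) := map_mx polyC X.
have m0 : minor0 (shift c) \is monic by rewrite minor0_shift // char_poly_monic.
have e : (res_at K (shift c) * \det (juxt (koszul_dim n_gt0) X' (Zmx (shift c)))) =
    \det (Dmx (shift c) *m X').
  apply: (monic_rreg m0); rewrite mulrAC -res_at_full.
  by rewrite (det_stack_juxt _ _ _ (DZ0 n_gt0 (shift c))).
have := congr1 (horner_eval 0) e; rewrite rmorphM -!det_map_mx map_juxt map_mxM.
rewrite map_Zmx map_Dmx -map_mx_comp (res_at_morph (horner_eval 0)).
have -> : (fun i p => horner_eval 0 (shift c i p)) = c.
  by do 2!apply: functional_extensionality => ?; rewrite /horner_eval shift_horner0.
suff -> : map_mx (horner_eval 0 \o polyC) X = X by [].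
by apply/matrixP => i j; rewrite mxE /= /horner_eval hornerC.
Qed.

(** K times [minor0] is, up to a unit, a characteristic polynomial. The degree of K along the pencil
    is thus dim S_{3n-1} - 3 dim S_{n-1} = 3n^2; being positive, it later excludes that K is a
    unit. *)
Lemma res_shift : (lead_coef (res_at K (shift g)) \is a GRing.unit) &&
  (1 < size (res_at K (shift g)))%N.
Proof.
set k := res_at K (shift g); set u := \det (juxt (koszul_dim n_gt0) (X0mx n {poly A}) (Zmx (@pure_coef n {poly A}))).
(* The inverse of u is [full0] at the pure powers, where both diagonal blocks of the product are
   identities. *)
have uu : u \is a GRing.unit.
  apply/unitrPr; exists (full0 n_gt0 (@pure_coef n {poly A})).
  by rewrite mulrC /full0 det_stack_juxt' ?E0X0 // DX0_pure // E0Z_pure // !det1 mulr1.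
have m0 : minor0 (shift g) = char_poly (- (E0mx n A *m Zmx g)) by rewrite minor0_shift.
have e : k * minor0 (shift g) * u = char_poly (- (Dmx g *m X0mx n A)).
  by rewrite -res_at_full full0_shift.
have := congr1 (fun p : {poly A} => lead_coef p) e.
rewrite !lead_coefM m0 !(monicP (char_poly_monic _)) mulr1 => lk.
have luk : lead_coef k \is a GRing.unit by apply/unitrPr; exists (lead_coef u).
rewrite luk /=.
have su : size u = 1%N by move: uu; rewrite poly_unitE => /andP[/eqP].
have k0 : k != 0 by rewrite -lead_coef_eq0; apply: contraTneq luk => ->; rewrite unitr0.
have c0 : char_poly (- (E0mx n A *m Zmx g)) != 0 by rewrite monic_neq0 // char_poly_monic.
have u0 : u != 0 by rewrite -size_poly_gt0 su.
have := congr1 (fun p : {poly A} => size p) e.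
rewrite m0 !size_mul ?mulf_neq0 // su !size_char_poly.
have := card_idx_pred n_gt0; have := @card_idx_pred (3 * n).
set sk := size k; set ww := #|idx n.-1|; set aa := #|idx _|.
move=> h1 h2 h3; nia.
Qed.

End Universal.

(** * Three forms without common zero *)

Section BinaryRestriction.

Variable k : fieldType.
Local Notation i0 := (ord0 : 'I_3).
Local Notation i1 := (lift ord0 ord0 : 'I_3).
Local Notation i2 := (ord_max : 'I_3).

(* Restriction to the line u = 0, in the affine coordinate s / t. *)
Definition line_val (i : 'I_3) : {poly k} :=
  if i == i0 then 'X else if i == i2 then 0 else 1.

Definition line_res : {rmorphism {mpoly k[3]} -> {poly k}} := mmap polyC line_val.

Lemma big_ord3 (T : Type) (idx : T) (op : Monoid.law idx) (f : 'I_3 -> T) :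
  \big[op/idx]_(i < 3) f i = op (op (f i0) (f i1)) (f i2).
Proof.
rewrite !big_ord_recr big_ord0 /= Monoid.mul1m.
by congr (op (op (f _) (f _)) (f _)); apply: val_inj.
Qed.

Lemma line_resX (m : 'X_{1..3}) :
  line_res 'X_[m] = (m i2 == 0%N)%:R *: 'X^(m i0).
Proof.
rewrite /line_res /= mmapX /mmap1 big_ord3 /line_val /= expr1n mulr1 expr0n.
by rewrite -mul_polyC polyC_natr mulrC.
Qed.

Lemma line_resZ c p : line_res (c *: p) = c *: line_res p.
Proof. by rewrite /line_res /= mmapZ mul_polyC. Qed.

Lemma line_resE d p : p \is d.-homog ->
  line_res p = \sum_(q : idx d) (p@_(mon q) * (mon q i2 == 0%N)%:R) *: 'X^(mon q i0).
Proof.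
move=> hp; rewrite {1}(form_coef hp) /form rmorph_sum; apply: eq_bigr => q _.
by rewrite line_resZ line_resX scalerA.
Qed.

Lemma size_line_res d p : p \is d.-homog -> (size (line_res p) <= d.+1)%N.
Proof.
move=> hp; rewrite (line_resE hp); apply: (leq_trans (size_sum _ _ _)).
apply/bigmax_leqP => q _; apply: (leq_trans (size_scale_leq _ _)).
by rewrite size_polyXn ltnS mon_le.
Qed.

Lemma line_res_coef d p (q : idx d) : p \is d.-homog -> mon q i2 = 0%N ->
  (line_res p)`_(mon q i0) = p@_(mon q).
Proof.
move=> hp q0; rewrite (line_resE hp) coef_sum (bigD1 q) //= q0 eqxx mulr1.
rewrite coefZ coefXn eqxx mulr1 big1 ?addr0 // => q' nq.
rewrite coefZ coefXn; case: (eqVneq (mon q' i2) 0%N) => q0'; last by rewrite mulr0 mul0r.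
case: eqP => e; last by rewrite mulr0.
case/eqP: nq; apply: (@mon_inj d); apply: mnm3P; rewrite ?q0 ?q0' //.
by have := mdeg_mon q; have := mdeg_mon q'; rewrite !mdeg3 q0 q0' -e; lia.
Qed.

Lemma line_res_eq0 d p : p \is d.+1.-homog -> line_res p = 0 ->
  exists2 p', p' \is d.-homog & p = p' * 'X_i2.
Proof.
move=> hp rp.
exists (\sum_(q : idx d.+1 | (0 < mon q i2)%N) p@_(mon q) *: 'X_[(mon q - U_(i2))%MM]).
  apply: rpred_sum => q q2; apply: rpredZ; rewrite dhomogX /=.
  have le : (U_(i2) <= mon q)%MM by rewrite lep1mP -lt0n.
  have := mdegD (mon q - U_(i2)) U_(i2); rewrite submK // mdeg_mon mdeg1.
  by move=> e; apply/eqP; lia.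
rewrite {1}(form_coef hp) /form (bigID (fun q : idx d.+1 => (0 < mon q i2)%N)) /=.
rewrite [X in _ + X]big1 ?addr0 => [|q]; last first.
  rewrite -eqn0Ngt => /eqP q0; rewrite -(line_res_coef hp q0) rp coef0.
  exact: scale0r.
rewrite mulr_suml; apply: eq_bigr => q q2.
by rewrite -scalerAl -mpolyXD submK // lep1mP -lt0n.
Qed.

Lemma line_res_lift d (f : {poly k}) : (size f <= d.+1)%N ->
  exists2 p, p \is d.-homog & line_res p = f.
Proof.
move=> sf; exists (\sum_(j < d.+1) f`_j *: 'X_[tri j (d - j) 0]).
  apply: rpred_sum => j _; apply: rpredZ; rewrite dhomogX /= mdeg3 !triE.
  by have := ltn_ord j; lia.
rewrite rmorph_sum -[RHS](coefK f) (poly_def (size f)).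
rewrite [RHS](big_ord_widen _ (fun j => f`_j *: 'X^j) sf) [RHS]big_mkcond.
apply: eq_bigr => j _; rewrite line_resZ line_resX !triE eqxx scale1r.
by case: ltnP => // le; rewrite nth_default // scale0r.
Qed.

Lemma line_res_horner p x :
  (line_res p).[x] = p.@[fun i => if i == i0 then x else if i == i2 then 0 else 1].
Proof.
rewrite [p]mpolyE rmorph_sum raddf_sum /= -horner_evalE rmorph_sum.
apply: eq_bigr => m _; rewrite line_resZ mevalZ.
rewrite /line_res /= mmapX mevalX /mmap1 /horner_eval hornerZ; congr (_ * _).
rewrite horner_prod; apply: eq_bigr => i _; rewrite horner_exp /line_val.
by case: eqP => _; [rewrite hornerX|case: eqP; rewrite ?hornerC].
Qed.

(** At the point (1 : 0 : 0) the coordinate s / t is infinite, so the top coefficient sees it and no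
    root does. *)
Lemma line_res_top d p : p \is d.-homog ->
  (line_res p)`_d = p.@[fun i => if i == i0 then 1 else 0].
Proof.
move=> hp; have dm : mdeg (tri d 0 0) = d by rewrite mdeg3 !triE !addn0.
have [q eq] := mon_surj dm.
have := line_res_coef hp (q := q); rewrite eq !triE => /(_ erefl) ->.
rewrite [in RHS](form_coef hp) raddf_sum /= (bigD1 q) //= big1 => [|q' nq].
  by rewrite addr0 mevalZ mevalX eq big_ord3 !triE /= expr1n !expr0 !mulr1.
rewrite mevalZ mevalX big_ord3 /= expr1n mul1r !expr0n.
case: (eqVneq (mon q' i1) 0%N) => [e1|]; last by rewrite mul0r mulr0.
case: (eqVneq (mon q' i2) 0%N) => [e2|]; last by rewrite !mulr0.
case/eqP: nq; apply: (@mon_inj d); apply: mnm3P; rewrite eq !triE ?e1 ?e2 //.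
by have := mdeg_mon q'; rewrite mdeg3 e1 e2 !addn0.
Qed.

End BinaryRestriction.

(** * Two forms that are coprime on the line u = 0 *)

Section LinePair.

Variables (k : fieldType) (n : nat) (G1 G2 : {mpoly k[3]}).
Local Notation i2 := (ord_max : 'I_3).
Hypotheses (n_gt0 : (0 < n)%N) (G1_homog : G1 \is n.-homog) (G2_homog : G2 \is n.-homog).
Local Notation g1 := (line_res k G1).
Local Notation g2 := (line_res k G2).
Hypotheses (size_g1 : size g1 = n.+1) (g_coprime : coprimep g1 g2).

Let g1_neq0 : g1 != 0.
Proof. by rewrite -size_poly_gt0 size_g1. Qed.

(** On the line, Bezout gives f = x g1 + y g2, and reducing y modulo g1 keeps both degrees small
    enough to lift; the rest vanishes on the line, so u divides it. The bound on d leaves room for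
    y, of degree at most n - 1. *)
Lemma pair_generate d p : p \is (d + n).-homog -> (n.-1 <= d)%N ->
  exists x y p', [/\ x \is d.-homog, y \is d.-homog, p' \is (d + n).-1.-homog
    & p = x * G1 + y * G2 + p' * 'X_i2].
Proof.
move=> hp led; set f := line_res k p.
have sf : (size f <= (d + n).+1)%N by apply: size_line_res.
have [[u v] /= uv] := Bezout_eq1_coprimepP _ _ g_coprime.
pose y0 := (f * v) %% g1.
have sy0 : (size y0 <= n)%N by rewrite -ltnS -size_g1 ltn_modp.
pose x0 := (f - y0 * g2) %/ g1.
have ex : x0 * g1 = f - y0 * g2.
  apply: divpK; rewrite -[f in f - _]mulr1 -uv mulrDr.
  rewrite [in X in _ %| X](_ : _ - _ = f * u * g1 + (f * v - y0) * g2); last by ring.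
  apply: dvdp_add; first exact: dvdp_mulIr.
  by apply: dvdp_mulr; rewrite {1}(divp_eq (f * v) g1) addrK dvdp_mulIr.
have sg2 : (size g2 <= n.+1)%N by apply: size_line_res.
have sx0 : (size x0 <= d.+1)%N.
  have [->|x0n] := eqVneq x0 0; first by rewrite size_poly0.
  have := size_mul x0n g1_neq0; rewrite ex size_g1 addnS /= => e.
  have : (size (f - y0 * g2)%R <= (d + n).+1)%N.
    apply: (leq_trans (size_polyD _ _)); rewrite geq_max sf size_polyN /=.
    apply: (leq_trans (size_polyMleq _ _)); rewrite -subn1.
    by apply: (leq_trans (leq_sub2r _ (leq_add sy0 sg2))); lia.
  by rewrite e -addSn leq_add2r.
have [x hx rx] := line_res_lift sx0.
have [|y hy ry] := @line_res_lift _ d y0; first by apply: (leq_trans sy0); lia.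
have hd : p - (x * G1 + y * G2) \is (d + n).-homog.
  by rewrite rpredB ?rpredD //; apply: dhomogM.
have [||p' hp' e] := @line_res_eq0 _ (d + n).-1 (p - (x * G1 + y * G2)).
- by rewrite prednK // addn_gt0 n_gt0 orbT.
- by rewrite rmorphB rmorphD !rmorphM rx ry ex; ring.
by exists x, y, p'; split=> //; rewrite -e addrC subrK.
Qed.

(** A form of the statement that u is a nonzerodivisor modulo the pair. On the line, coprimality
    makes the relation a multiple c of the Koszul relation (-g2, g1); subtracting a lift of it makes
    both coefficients divisible by u. *)
Lemma pair_divide e a b p : (n <= e.+1)%N -> a \is e.+1.-homog -> b \is e.+1.-homog ->
  p * 'X_i2 = a * G1 + b * G2 ->
  exists a' b', [/\ a' \is e.-homog, b' \is e.-homog & p = a' * G1 + b' * G2].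
Proof.
move=> lene ha hb epu.
have e0 : line_res k a * g1 + line_res k b * g2 = 0.
  rewrite -!rmorphM -rmorphD -epu rmorphM -['X_i2]/('X_[U_(i2)]).
  by rewrite line_resX mnm1E scale0r mulr0.
have /dvdpP[c ec] : g1 %| line_res k b.
  rewrite -(Gauss_dvdpl _ g_coprime); move/eqP: e0; rewrite addrC addr_eq0 => /eqP ->.
  by rewrite dvdpNr dvdp_mulIr.
have ec' : line_res k a = - (c * g2).
  by apply: (mulIf g1_neq0); apply/eqP; rewrite -subr_eq0; rewrite -[X in _ == X]e0 ec; apply/eqP; ring.
have sc : (size c <= (e.+1 - n).+1)%N.
  have [->|c0] := eqVneq c 0; first by rewrite size_poly0.
  have := size_line_res hb; rewrite ec size_mul // size_g1 addnS /=.
  by move: (size c) => sc h; lia.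
have [c' hc' rc'] := line_res_lift sc.
have hG G : G \is n.-homog -> c' * G \is e.+1.-homog.
  by move=> hG; rewrite -(subnK lene); apply: dhomogM.
have [||a' ha' ea'] := @line_res_eq0 _ e (a + c' * G2).
- by rewrite rpredD // hG.
- by rewrite rmorphD rmorphM rc' ec' addNr.
have [||b' hb' eb'] := @line_res_eq0 _ e (b - c' * G1).
- by rewrite rpredB // hG.
- by rewrite rmorphB rmorphM rc' ec subrr.
exists a', b'; split=> //.
have X0 : 'X_i2 != 0 :> {mpoly k[3]} by rewrite -msupp_eq0 msuppX.
apply: (mulIf X0); rewrite mulrDl mulrAC -ea' [b' * _ * _]mulrAC -eb' epu; ring.
Qed.

End LinePair.

Lemma left_kernel_ann (k : fieldType) a N (D : 'M[k]_(a, N)) (v : 'cV_a) :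
  kermx D *m v = 0 -> exists z, v = D *m z.
Proof.
move=> kv; suff /submxP[z ez] : (v^T <= D^T)%MS.
  by exists z^T; rewrite -[v]trmxK ez trmx_mul trmxK.
rewrite submxE; set C := cokermx _.
have /sub_kermxP/submxP[Y eY] : C^T *m D = 0.
  by rewrite -[D]trmxK -trmx_mul mulmx_coker trmx0.
by rewrite -[C]trmxK -trmx_mul eY -mulmxA kv mulmx0 trmx0.
Qed.

Lemma closed_eigenvector (k : closedFieldType) r (S : 'M[k]_r) : (0 < r)%N ->
  exists2 v : 'rV_r, v != 0 & exists al, v *m S = al *: v.
Proof.
move=> r0; have /closed_rootP[al] : size (char_poly S) != 1%N.
  by rewrite size_char_poly; case: (r) r0.
rewrite -eigenvalue_root_char => /eigenvalueP[v vS v0].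
by exists v => //; exists al.
Qed.

Lemma commuting_eigenvector (k : closedFieldType) r (S T : 'M[k]_r) :
  (0 < r)%N -> S *m T = T *m S ->
  exists2 v : 'rV_r, v != 0 & exists al be, v *m S = al *: v /\ v *m T = be *: v.
Proof.
move=> r0 ST; have [u u0 [al uS]] := closed_eigenvector S r0.
pose E := eigenspace S al; pose B := row_base E.
have BS : B *m S = al *: B by apply/eigenspaceP; rewrite eq_row_base.
have rB : (0 < \rank E)%N.
  rewrite lt0n mxrank_eq0; apply: contraNneq u0 => E0.
  have : (u <= E)%MS by apply/eigenspaceP.
  by rewrite E0 submx0.
have BT : (B *m T <= B)%MS.
  by rewrite eq_row_base; apply/eigenspaceP; rewrite -mulmxA -ST mulmxA BS scalemxAl.
(* T preserves the eigenspace of S; this product is the matrix of T in the basis B of that space. *)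
have [v v0 [be vT]] := closed_eigenvector (B *m T *m pinvmx B) rB.
exists (v *m B).
  have /row_freeP[C BC] := row_base_free E.
  by apply: contraNneq v0 => vB; rewrite -[v]mulmx1 -BC mulmxA vB mul0mx.
exists al, be; split; first by rewrite -mulmxA BS -scalemxAr.
by rewrite -mulmxA -(mulmxKpV BT) mulmxA vT scalemxAl.
Qed.

Lemma col_mulmx (R : comNzRingType) m p r (A : 'M[R]_(m, p)) (B : 'M_(p, r)) j :
  col j (A *m B) = A *m col j B.
Proof. by rewrite !colE mulmxA. Qed.

Lemma mul_vec_mon (R : comNzRingType) l (la : 'rV[R]_#|idx l|) j :
  (la *m vec l 'X_[mon (enum_val j)]) 0 0 = la 0 j.
Proof.
rewrite mxE (bigD1 j) //= mxE mcoeffX eqxx mulr1 big1 ?addr0 // => i ij.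
rewrite mxE mcoeffX (inj_eq (@mon_inj l)) (inj_eq enum_val_inj).
by rewrite eq_sym (negPf ij) mulr0.
Qed.

(** * Surjectivity of D for forms without common zero *)

Section NoCommonZero.

Variables (k : closedFieldType) (n : nat) (c : 'I_3 -> idx n -> k).
Hypothesis n_gt0 : (0 < n)%N.
Local Notation i0 := (ord0 : 'I_3).
Local Notation i1 := (lift ord0 ord0 : 'I_3).
Local Notation i2 := (ord_max : 'I_3).
Local Notation F i := (form (c i)).
Local Notation l1 := n.-1.
Local Notation l2 := (2 * n).-1.
Local Notation l3 := (3 * n).-1.

Hypothesis no_zero : ~ common_zero (fun i => form (c i)).

Lemma nonzero_at (a : 'I_3 -> k) : (exists i, a i != 0) -> exists i, (F i).@[a] != 0.
Proof.
move=> a0; have [/existsP[i Fi]|/existsPn h] := boolP [exists i, (F i).@[a] != 0].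
  by exists i.
by case: no_zero; exists a => // i; apply/eqP; rewrite -[_ == _]negbK h.
Qed.

(* Two combinations of the three forms without common zero on the line u = 0. *)
Lemma line_pair : exists x y : 'I_3 -> k,
  size (line_res k (\sum_i x i *: F i)) = n.+1 /\
  coprimep (line_res k (\sum_i x i *: F i)) (line_res k (\sum_i y i *: F i)).
Proof.
(* A form that does not vanish at (1 : 0 : 0) keeps its full degree n on the line. *)
have [|j Fj] := @nonzero_at (fun i => if i == i0 then 1 else 0).
  by exists i0; rewrite eqxx oner_neq0.
pose x i : k := (i == j)%:R.
have ex : \sum_i x i *: F i = F j.
  by rewrite (bigD1 j) //= /x eqxx scale1r big1 ?addr0 // => i /negPf ->; rewrite scale0r.
have s1 : size (line_res k (F j)) = n.+1.
  apply/eqP; rewrite eqn_leq size_line_res ?form_homog //= ltnNge.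
  apply: contra Fj => /leq_sizeP/(_ _ (leqnn n)).
  by rewrite (line_res_top (form_homog _)) => ->.
pose f i := line_res k (F i).
(* As a polynomial in y0, [h r] is the value at (r : 1 : 0) of F_0 + y0 F_1 + y0^2 F_2. It is
   nonzero for every r, so a single y0 avoids its roots for all roots r of [f j]. *)
pose h r : {poly k} := (f i0).[r]%:P + (f i1).[r] *: 'X + (f i2).[r] *: 'X^2.
have h0 r : h r != 0.
  have [|i Fi] := @nonzero_at (fun i => if i == i0 then r else if i == i2 then 0 else 1).
    by exists i1; rewrite /= oner_neq0.
  rewrite -line_res_horner -/(f i) in Fi; apply: contra_neq Fi => hr0.
  have hc j' : (h r)`_j' = 0 by rewrite hr0 coef0.
  have := (hc 0%N, hc 1%N, hc 2%N).
  rewrite /h !coefD !coefZ !coefC !coefX !coefXn /= !mulr0 !mulr1 !addr0 !add0r.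
  move=> [[e0 e1] e2].
  by case: i => [[|[|[|//]]] lt]; [rewrite -[RHS]e0|rewrite -[RHS]e1|rewrite -[RHS]e2];
     congr (_.[r]); congr (f _); apply: val_inj.
have [rs ers] := closed_field_poly_normal (f j).
have /closed_nonrootP[y0 hy0] : \prod_(r <- rs) h r != 0.
  by rewrite prodf_seq_neq0; apply/allP => r _; rewrite h0.
pose y (i : 'I_3) := y0 ^+ i.
exists x, y; rewrite ex; split=> //; apply: Pdiv.ClosedField.root_coprimep => r.
rewrite -/(f j) ers rootZ; last by rewrite lead_coef_eq0 -size_poly_gt0 s1.
rewrite root_prod_XsubC => rrs.
have : (h r).[y0] != 0.
  by move: hy0; rewrite rootE horner_prod prodf_seq_neq0 => /allP/(_ r rrs).
rewrite rmorph_sum big_ord3 /= !line_resZ !hornerD !hornerZ /y /h.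
rewrite hornerC hornerX hornerXn /f -[y0 ^+ i0]/1 -[y0 ^+ i1]/(y0 ^+ 1) expr1 mul1r.
by rewrite ![(line_res k _).[r] * _]mulrC.
Qed.

Definition in_ideal (p : {mpoly k[3]}) :=
  exists2 q : 'I_3 -> {mpoly k[3]}, (forall i, q i \is l2.-homog) &
    p = \sum_i q i * F i.

Lemma in_idealD p p' : in_ideal p -> in_ideal p' -> in_ideal (p + p').
Proof.
move=> [q hq ->] [q' hq' ->]; exists (fun i => q i + q' i).
  by move=> i; rewrite rpredD.
by rewrite -big_split; apply: eq_bigr => i _; rewrite mulrDl.
Qed.

Lemma in_ideal_comb (x : 'I_3 -> k) p : p \is l2.-homog ->
  in_ideal (p * \sum_i x i *: F i).
Proof.
move=> hp; exists (fun i => x i *: p); first by move=> i; apply: rpredZ.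
by rewrite mulr_sumr; apply: eq_bigr => i _; rewrite -scalerAr scalerAl.
Qed.

Lemma in_ideal_Dmx p : in_ideal p -> exists z, vec l3 p = Dmx c *m z.
Proof.
move=> [q hq ->]; exists (col_mx (vec l2 (q i0)) (col_mx (vec l2 (q i1)) (vec l2 (q i2)))).
by rewrite /Dmx blk_mul !Mul_vec // big_ord3 !vecD addrA.
Qed.

Lemma Dmx_in_ideal z : exists2 p, in_ideal p & vec l3 p = Dmx c *m z.
Proof.
pose q i := pol (if i == i0 then usubmx z else if i == i1 then usubmx (dsubmx z)
                 else dsubmx (dsubmx z)) : {mpoly k[3]}.
have hq i : q i \is l2.-homog by apply: pol_homog.
exists (\sum_i q i * F i); first by exists q.
rewrite big_ord3 !vecD -!(Mul_vec (l := l2)) // !polK /=.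
by rewrite -[in RHS](vsubmxK z) -[in RHS](vsubmxK (dsubmx z)) /Dmx blk_mul addrA.
Qed.

(** This makes division by u well defined on the functionals that vanish on the ideal. The
    multipliers of p u are split along [line_pair]; their parts carrying u go to the other side, and
    [pair_divide] removes u. So p is a combination with multipliers of degree 2n - 2, leaving room
    for 'X_i. *)
Lemma ideal_shift i p : p \is l3.-1.-homog ->
  in_ideal (p * 'X_i2) -> in_ideal (p * 'X_i).
Proof.
have [x [y [s1 cop]]] := line_pair.
have hcomb (z : 'I_3 -> k) : \sum_j z j *: F j \is n.-homog.
  by apply: rpred_sum => j _; apply/rpredZ/form_homog.
set G1 := \sum_j x j *: F j in s1 cop; set G2 := \sum_j y j *: F j in cop.
have hX j : ('X_j : {mpoly k[3]}) \is 1.-homog by rewrite dhomogX /= mdeg1.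
have [e12 e2] : (l1 + n)%N = l2 /\ l2.-1.+1 = l2 by lia.
move=> hp [q hq e].
have /fin_all_exists[t ht] : forall j, exists t : {mpoly k[3]} * {mpoly k[3]} * {mpoly k[3]},
    [/\ t.1.1 \is l1.-homog, t.1.2 \is l1.-homog, t.2 \is l2.-1.-homog
      & q j = t.1.1 * G1 + t.1.2 * G2 + t.2 * 'X_i2].
  move=> j; have [||u [v [r [hu hv hr er]]]] :=
    @pair_generate _ n G1 G2 n_gt0 (hcomb x) (hcomb y) s1 cop l1 (q j).
  - by rewrite e12.
  - by [].
  by exists (u, v, r); split=> //; rewrite -e12.
pose p1 := p - \sum_j (t j).2 * F j.
have e1 : p1 * 'X_i2 =
    (\sum_j (t j).1.1 * F j) * G1 + (\sum_j (t j).1.2 * F j) * G2.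
  rewrite mulrBl e !mulr_suml -sumrB -big_split; apply: eq_bigr => j _ /=.
  by have [_ _ _ ->] := ht j; ring.
have [|||a' [b' [ha hb ep1]]] :=
    @pair_divide _ n G1 G2 n_gt0 (hcomb x) (hcomb y) s1 cop l2.-1 _ _ _ _ _ _ e1.
- by lia.
- by rewrite e2 -e12; apply: rpred_sum => j _; apply: dhomogM (form_homog _); have [] := ht j.
- by rewrite e2 -e12; apply: rpred_sum => j _; apply: dhomogM (form_homog _); have [] := ht j.
have -> : p * 'X_i = \sum_j ((t j).2 * 'X_i) * F j + (a' * 'X_i * G1 + b' * 'X_i * G2).
  have -> : p = \sum_j (t j).2 * F j + (a' * G1 + b' * G2) by rewrite -ep1 addrC subrK.
  rewrite !mulrDl mulr_suml; congr (_ + (_ + _)); [|ring|ring].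
  by apply: eq_bigr => j _; ring.
have hM (r : {mpoly k[3]}) : r \is l2.-1.-homog -> r * 'X_i \is l2.-homog.
  move=> hr; have -> : l2 = (l2.-1 + 1)%N by lia.
  exact: dhomogM hr (hX i).
apply: in_idealD; last by apply: in_idealD; apply: in_ideal_comb; apply: hM.
by exists (fun j => (t j).2 * 'X_i) => // j; apply: hM; have [] := ht j.
Qed.

Lemma ideal_generate d p : p \is (d + n).-homog -> (n.-1 <= d)%N ->
  exists p' (s : 'I_2 -> {mpoly k[3]}) (x : 'I_2 -> 'I_3 -> k),
  [/\ p' \is (d + n).-1.-homog, forall j, s j \is d.-homog
    & p = \sum_j s j * (\sum_i x j i *: F i) + p' * 'X_i2].
Proof.
have [x [y [s1 cop]]] := line_pair.
have hcomb (z : 'I_3 -> k) : \sum_j z j *: F j \is n.-homog.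
  by apply: rpred_sum => j _; apply/rpredZ/form_homog.
move=> hp led; have [u [v [r [hu hv hr er]]]] :=
  pair_generate n_gt0 (hcomb x) (hcomb y) s1 cop hp led.
exists r, (fun j => if j == 0 then u else v), (fun j => if j == 0 then x else y).
split=> //; first by move=> j; case: ifP.
by rewrite er; congr (_ + _); rewrite [RHS]big_ord_recl big_ord1.
Qed.

Lemma row_kills (la : 'rV[k]_#|idx l3|) p : la *m Dmx c = 0 -> in_ideal p ->
  la *m vec l3 p = 0.
Proof. by move=> laD /in_ideal_Dmx[z ->]; rewrite mulmxA laD mul0mx. Qed.

Local Notation U1 i := (Mul (R := k) l3.-1 l3 'X_i).
Local Notation U2 i := (Mul (R := k) l3.-2 l3.-1 'X_i).

(** Modulo the ideal every form of degree 3n - 1 is a multiple of u^2, by [ideal_generate] twice. It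
    serves to prove that s/u and t/u commute, which is checked after multiplication by u^2. *)
Lemma kernel_zero (la : 'rV[k]_#|idx l3|) :
  la *m Dmx c = 0 -> la *m U1 i2 *m U2 i2 = 0 -> la = 0.
Proof.
move=> laD laU.
have hX j : ('X_j : {mpoly k[3]}) \is 1.-homog by rewrite dhomogX /= mdeg1.
have e23 : (l2 + n)%N = l3 by lia.
have e3 : (l2.-1 + n)%N = l3.-1 by lia.
have kill p : p \is l3.-homog -> la *m vec l3 p = 0.
  move=> hp.
  have [||p' [s [x [hp' hs ep]]]] := @ideal_generate l2 p; [by rewrite e23|by lia|].
  rewrite e23 in hp'; rewrite ep vecD mulmxDr.
  rewrite vec_sum mulmx_sumr big1 ?add0r; last first.
    by move=> j _; apply: row_kills => //; apply: in_ideal_comb.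
  have [||p2 [s' [x' [hp2 hs' ep']]]] := @ideal_generate l2.-1 p'; [by rewrite e3|by lia|].
  rewrite e3 in hp2; rewrite ep' mulrDl vecD mulmxDr mulr_suml.
  rewrite vec_sum mulmx_sumr big1 ?add0r; last first.
    move=> j _; apply: row_kills => //; rewrite mulrAC; apply: in_ideal_comb.
    have -> : l2 = (l2.-1 + 1)%N by lia.
    exact: dhomogM (hX _).
  have hpX : p2 * 'X_i2 \is l3.-1.-homog.
    have -> : l3.-1 = (l3.-2 + 1)%N by lia.
    exact: dhomogM (hX _).
  by rewrite -(Mul_vec _ _ hpX) -(Mul_vec _ _ hp2) !mulmxA laU mul0mx.
apply/rowP => j; rewrite [RHS]mxE -mul_vec_mon (kill _ (mon_homog k (enum_val j))).
by rewrite mxE.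
Qed.

(* A right inverse of D exists: otherwise the functionals that vanish on the
   ideal form a nonzero space, on which s/u and t/u act by commuting operators;
   a common eigenvector is evaluation at a common zero. *)
Lemma kernel_Dmx0 : kermx (Dmx c) = 0.
Proof.
have hX j : ('X_j : {mpoly k[3]}) \is 1.-homog by rewrite dhomogX /= mdeg1.
have homogX (p : {mpoly k[3]}) j : p \is l3.-1.-homog -> p * 'X_j \is l3.-homog.
  move=> hp; have -> : l3 = (l3.-1 + 1)%N by lia.
  exact: dhomogM hp (hX j).
apply/eqP; rewrite -mxrank_eq0 eqn0Ngt; apply/negP => rk0.
have [r [r0 [B [/row_freeP[C BC] BD Bk]]]] : exists r, (0 < r)%N /\ exists B : 'M_(r, _),
    [/\ row_free B, B *m Dmx c = 0 & (kermx (Dmx c) <= B)%MS].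
  exists (\rank (kermx (Dmx c))); split=> //; exists (row_base (kermx (Dmx c))).
  by rewrite row_base_free; split=> //; [apply/sub_kermxP|]; rewrite eq_row_base.
(* If the whole left kernel annihilates v u, then v u is in the ideal, and so is v times any
   variable; hence the rows of [B *m U1 i] depend on those of [B *m U1 i2]. *)
have shiftB i : (B *m U1 i <= B *m U1 i2)%MS.
  rewrite submxE; apply/eqP/matrixP => r' s; rewrite [RHS]mxE.
  set C' := cokermx _; pose v := col s C'.
  have : B *m U1 i2 *m v = 0 by rewrite -col_mulmx mulmx_coker col0.
  have hv := pol_homog v; rewrite -(polK v) -!mulmxA !Mul_vec // => Bv.
  have [z ez] : exists z, vec l3 (pol v * 'X_i2) = Dmx c *m z.
    apply: left_kernel_ann.
    have /submxP[Y eY] := Bk.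
    by rewrite eY -(mulmxA Y) Bv mulmx0.
  have [p hp ep] := Dmx_in_ideal z.
  have hpv : in_ideal (pol v * 'X_i2).
    suff -> : pol v * 'X_i2 = p by [].
    apply: (@vec_inj _ l3); rewrite ?ez ?ep //; first exact: homogX.
    case: hp => t ht ->; have -> : l3 = (l2 + n)%N by lia.
    by apply: rpred_sum => j _; apply: dhomogM (form_homog _).
  have Bs : B *m vec l3 (pol v * 'X_i) = 0.
    have [z' ->] := in_ideal_Dmx (ideal_shift i hv hpv).
    by rewrite mulmxA BD mul0mx.
  have : (B *m U1 i *m v) r' 0 = 0.
    by rewrite -(polK v) -!mulmxA Mul_vec // Bs mxE.
  by rewrite /v -col_mulmx mxE -mulmxA.
have /submxP[S eS] := shiftB i0; have /submxP[T eT] := shiftB i1.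
have comm i j : U1 i *m U2 j = U1 j *m U2 i.
  by apply: (@Mul_comm _ _ _ _ 1); [exact: hX | exact: hX | lia].
(* Composing the two operators in either order and multiplying by u^2 gives multiplication by s
   t. *)
have key i j Si Sj : B *m U1 i = Si *m (B *m U1 i2) -> B *m U1 j = Sj *m (B *m U1 i2) ->
    Si *m (Sj *m (B *m (U1 i2 *m U2 i2))) = B *m (U1 i *m U2 j).
  move=> ei ej; transitivity (Si *m (B *m U1 j *m U2 i2)); first by rewrite ej !mulmxA.
  by rewrite -(mulmxA B) (comm j i2) [RHS]mulmxA ei !mulmxA.
have ST : S *m T = T *m S.
  apply/eqP; rewrite -subr_eq0 -[_ - _]mulmx1 -BC mulmxA; apply/eqP.
  suff -> : (S *m T - T *m S) *m B = 0 by rewrite mul0mx.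
  apply/row_matrixP => j; rewrite row0; apply: kernel_zero.
    by rewrite -row_mul -mulmxA BD mulmx0 row0.
  rewrite -!row_mul !mulmxBl -!mulmxA (key _ _ _ _ eS eT) (key _ _ _ _ eT eS).
  by rewrite comm subrr row0.
have [v v0 [al [be [vS vT]]]] := commuting_eigenvector r0 ST.
pose la := v *m B.
have laD : la *m Dmx c = 0 by rewrite -mulmxA BD mulmx0.
have la0 : la != 0.
  by apply: contraNneq v0 => vB; rewrite -[v]mulmx1 -BC mulmxA -/la vB mul0mx.
have laS : la *m U1 i0 = al *: (la *m U1 i2).
  by rewrite -!mulmxA eS (mulmxA v S) vS -scalemxAl.
have laT : la *m U1 i1 = be *: (la *m U1 i2).
  by rewrite -!mulmxA eT (mulmxA v T) vT -scalemxAl.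
pose f p := (la *m vec l3 p) 0 0.
(* On the common eigenvector a factor s or t is traded for u at the price of [al] or [be], so f is
   evaluation at (al : be : 1) times its value at u^(3n-1). *)
have fstep i ga x y z : la *m U1 i = ga *: (la *m U1 i2) -> (x + y + z = l3.-1)%N ->
    f 'X_[(tri x y z + U_(i))%MM] = ga * f 'X_[(tri x y z + U_(i2))%MM].
  move=> e exyz; have hp : ('X_[tri x y z] : {mpoly k[3]}) \is l3.-1.-homog.
    by rewrite dhomogX /= mdeg3 !triE exyz.
  rewrite /f !mpolyXD -!(Mul_vec _ _ hp) !mulmxA e -scalemxAl mxE //.
have triS0 x y z : (tri x y z + U_(i0))%MM = tri x.+1 y z.
  by apply: mnm3P; rewrite mnmDE mnm1E !triE /= ?addn0 ?addn1.
have triS1 x y z : (tri x y z + U_(i1))%MM = tri x y.+1 z.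
  by apply: mnm3P; rewrite mnmDE mnm1E !triE /= ?addn0 ?addn1.
have triS2 x y z : (tri x y z + U_(i2))%MM = tri x y z.+1.
  by apply: mnm3P; rewrite mnmDE mnm1E !triE /= ?addn0 ?addn1.
have feval x y z : (x + y + z = l3)%N ->
    f 'X_[tri x y z] = al ^+ x * be ^+ y * f 'X_[tri 0 0 l3].
  elim: x y z => [|x IHx] y z; last first.
    move=> e; have h : (x + y + z = l3.-1)%N by lia.
    by rewrite -triS0 (fstep _ _ _ _ _ laS h) triS2 IHx ?exprS; [ring|lia].
  elim: y z => [|y IHy] z; last first.
    move=> e; have h : (0 + y + z = l3.-1)%N by lia.
    by rewrite -triS1 (fstep _ _ _ _ _ laT h) triS2 IHy ?exprS; [ring|lia].
  by rewrite !add0n => ->; rewrite !expr0 !mul1r.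
pose pt (i : 'I_3) : k := if i == i0 then al else if i == i1 then be else 1.
have fD p q : f (p + q) = f p + f q by rewrite /f vecD mulmxDr mxE.
have fZ t p : f (t *: p) = t * f p by rewrite /f vecZ -scalemxAr mxE.
have f0 : f 0 = 0 by rewrite /f vec0 mulmx0 mxE.
have fE p : p \is l3.-homog -> f p = p.@[pt] * f 'X_[tri 0 0 l3].
  move=> hp; rewrite (form_coef hp) /form (big_morph f fD f0) raddf_sum /= mulr_suml.
  apply: eq_bigr => q _; rewrite fZ mevalZ -mulrA; congr (_ * _).
  rewrite mevalX big_ord3 /= expr1n mulr1 [in LHS](tri_eta (mon q)) feval //.
  by rewrite -mdeg3 mdeg_mon.
have fu : f 'X_[tri 0 0 l3] != 0.
  apply: contraNneq la0 => fu; apply/eqP/rowP => j; rewrite [RHS]mxE.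
  have := fE _ (mon_homog k (enum_val j)); rewrite fu mulr0 => <-.
  by rewrite /f mul_vec_mon.
apply: no_zero; exists pt; first by exists i2; rewrite oner_neq0.
(* f kills u^(2n-1) F_i, which lies in the ideal; u is 1 at the point, so F_i vanishes there. *)
move=> i; have hu : ('X_[tri 0 0 l2] : {mpoly k[3]}) \is l2.-homog.
  by rewrite dhomogX /= mdeg3 !triE.
have /(congr1 (fun A : 'M_1 => A 0 0)) : la *m vec l3 ('X_[tri 0 0 l2] * form (c i)) = 0.
  apply: row_kills => //; exists (fun j => if j == i then 'X_[tri 0 0 l2] else 0).
    by move=> j; case: ifP => // _; apply: rpred0.
  by rewrite (bigD1 i) //= eqxx big1 ?addr0 // => j /negPf ->; rewrite mul0r.
rewrite [RHS]mxE -/(f _) fE; last first.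
  have -> : l3 = (l2 + n)%N by lia.
  by apply: dhomogM (form_homog _).
move=> /eqP; rewrite mulf_eq0 (negPf fu) orbF mevalM mevalX big_ord3 !triE /=.
by rewrite !expr0 expr1n !mul1r => /eqP.
Qed.

Lemma right_inverse : exists X, Dmx c *m X = 1%:M.
Proof. by apply/row_freeP; rewrite -kermx_eq0 kernel_Dmx0. Qed.

End NoCommonZero.

(** * Comparison with the resultant *)

Section CountableFraction.

Variable n : nat.
Local Notation A := {mpoly int[n]}.

Let code_mpoly (p : A) : seq ('X_{1..n} * int) := [seq (m, p@_m) | m <- msupp p].
Let decode_mpoly (s : seq ('X_{1..n} * int)) : A := \sum_(x <- s) x.2 *: 'X_[x.1].

Let code_mpolyK : cancel code_mpoly decode_mpoly.
Proof. by move=> p; rewrite /decode_mpoly big_map [RHS]mpolyE. Qed.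

Let code_frac (x : {fraction A}) := (code_mpoly (\n_(repr x)), code_mpoly (\d_(repr x))).
Let decode_frac c : {fraction A} :=
  (\pi_({fraction A}) (Ratio (decode_mpoly c.1) (decode_mpoly c.2)))%qT.

Let code_fracK : cancel code_frac decode_frac.
Proof.
move=> x; rewrite /decode_frac /= !code_mpolyK -[RHS]reprK; congr (_ _).
apply: val_inj; rewrite /= [LHS]surjective_pairing !numden_Ratio ?denom_ratioP //.
by rewrite -surjective_pairing.
Qed.

(** Roots along the generic pencil are compared in a closed field containing the generic
    coefficients, and injectivity brings divisibility back. [countable_algebraic_closure] takes a
    countable field, whence the coding of fractions by lists of coefficients. *)
Lemma closed_embedding : exists (k : closedFieldType) (f : {rmorphism A -> k}), injective f.
Proof.
pose F := {fraction A}.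
pose cF : countFieldType := HB.pack F (CanIsCountable code_fracK).
have [k [f _]] := countable_algebraic_closure cF.
pose h : {rmorphism F -> k} := f.
exists k, (h \o (@tofrac A)) => x y /= /fmorph_inj e.
by apply/eqP; rewrite -tofrac_eq e.
Qed.

End CountableFraction.

(** Over k the image of p splits and each root is shared, so it divides a power of the image of q.
    As p has a unit leading coefficient, that power of q can be divided by p over B; the remainder
    maps to a multiple of the image of p of smaller degree, that is to 0. *)
Lemma dvd_power_of_roots (k : closedFieldType) (B : idomainType) (f : {rmorphism B -> k})
    (p q : {poly B}) :
  injective f -> lead_coef p \is a GRing.unit ->
  (forall x, root (map_poly f p) x -> root (map_poly f q) x) ->
  exists r s, q ^+ r = s * p.
Proof.
move=> f_inj up pq; set P := map_poly f p; set Q := map_poly f q.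
have p0 : p != 0 by rewrite -lead_coef_eq0; apply: contraTneq up => ->; rewrite unitr0.
have P0 : P != 0.
  apply: contraNneq p0 => P0; apply/eqP/(map_inj_poly f_inj (rmorph0 f)).
  by rewrite rmorph0.
have [rs ers] := closed_field_poly_normal P.
have dvdQ : P %| Q ^+ size rs.
  rewrite ers dvdpZl ?lead_coef_eq0 //.
  have : {subset rs <= root Q}.
    move=> x xrs; apply: pq; rewrite -/P ers rootZ ?lead_coef_eq0 //.
    by rewrite root_prod_XsubC.
  elim: (rs) => [|x s IH] sub; first by rewrite big_nil dvd1p.
  rewrite big_cons exprS; apply: dvdp_mul.
    by rewrite dvdp_XsubCl; apply: sub; rewrite mem_head.
  by apply: IH => y ys; apply: sub; rewrite inE ys orbT.
set r := size rs in dvdQ; exists r, (q ^+ r %/ p).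
have e := Pdiv.IdomainUnit.divp_eq up (q ^+ r).
suff r0 : q ^+ r %% p = 0 by rewrite {1}e r0 addr0.
apply: (map_inj_poly f_inj (rmorph0 f)); rewrite rmorph0; apply/eqP.
have : P %| map_poly f (q ^+ r %% p).
  have -> : map_poly f (q ^+ r %% p) = Q ^+ r - map_poly f (q ^+ r %/ p) * P.
    by rewrite -rmorphXn -rmorphM {2}e rmorphD addrC addKr.
  by rewrite dvdp_subr // dvdp_mulIr.
apply: contraTT => n0; apply/negP => /(dvdp_leq n0).
rewrite leqNgt !(size_map_inj_poly f_inj (rmorph0 f)) ltn_modp p0 //.
Qed.

Section Divisibility.

Variable n : nat.
Hypothesis n_gt0 : (0 < n)%N.
Local Notation A := {mpoly int[#|coef_idx 3 n|]}.
Local Notation g := (@generic n).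

Variables K R : A.
Hypothesis KP : full0 n_gt0 g = K * minor0 g.
Hypothesis R_res : is_resultant R.

Lemma resultant_power : exists r S, R ^+ r = S * K.
Proof.
have [k [f f_inj]] := closed_embedding #|coef_idx 3 n|.
have /andP[lk _] := res_shift KP.
have evalE x (P : A) : (map_poly f (res_at P (shift g))).[x] =
    res_at P (fun i p => (map_poly f (shift g i p)).[x]).
  rewrite (res_at_morph (map_poly f)) -!horner_evalE.
  exact: (res_at_morph (horner_eval x)).
have [|r [s e]] := @dvd_power_of_roots k _ f _ (res_at R (shift g)) f_inj lk.
  move=> x; rewrite !rootE !evalE; set c := fun i p => _.
  (* Where R does not vanish there is no common zero, so D has a right inverse and the value of K
     divides 1. *)
  apply: contraTT => Rc.
  have nz : ~ common_zero (fun i => form (c i)).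
    by move=> /(R_res.2 k c) z; rewrite z eqxx in Rc.
  have [X DX] := right_inverse n_gt0 nz.
  have := res_at_det KP c X; rewrite DX det1; apply: contra_eq_neq => ->.
  by rewrite mul0r eq_sym oner_neq0.
exists r, s.[0].
have := congr1 (horner_eval 0) e; rewrite rmorphXn rmorphM !(res_at_morph (horner_eval 0)).
have -> : (fun i p => horner_eval 0 (shift g i p)) = g.
  by do 2!apply: functional_extensionality => ?; rewrite /horner_eval shift_horner0.
by rewrite !res_at_generic.
Qed.

Lemma resultant_is_power : exists u j, [/\ u \is a GRing.unit, (0 < j)%N & K = u * R ^+ j].
Proof.
have [r [S e]] := resultant_power.
have pR := irreducible_prime (@factorial_mpoly_int _) R_res.1.
have [u [j [uu eK]]] := dvd_prime_exp pR (etrans (mulrC K S) (esym e)).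
(* j = 0 would make K constant, against its positive degree along the pencil. *)
exists u, j; split=> //; case: j => // in eK *.
have := res_shift KP; rewrite eK expr0 mulr1 => /andP[_].
move: uu; rewrite unfold_in /= => /andP[/eqP -> _].
by rewrite /res_at mmapC /= -(rmorph_int polyC) size_polyC ltnNge leq_b1.
Qed.

End Divisibility.

Lemma meval_map_mpoly (R S : comNzRingType) (f : {rmorphism R -> S}) m (p : {mpoly R[m]})
    (v : 'I_m -> R) :
  (map_mpoly f p).@[fun i => f (v i)] = f p.@[v].
Proof.
rewrite [p]mpolyE (raddf_sum (map_mpoly f)) !(raddf_sum (meval _)) rmorph_sum /=.
apply: eq_bigr => h _.
rewrite map_mpolyZ map_mpolyX !mevalZ !mevalX rmorphM rmorph_prod; congr (_ * _).
by apply: eq_bigr => i _; rewrite rmorphXn.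
Qed.

(** * The exponent is 1: a system whose resultant is exactly divisible by 2 *)

Section UnitExponent.

Variable n : nat.
Hypothesis n_gt0 : (0 < n)%N.
Local Notation A := {mpoly int[#|coef_idx 3 n|]}.
Local Notation i0 := (ord0 : 'I_3).
Local Notation i1 := (lift ord0 ord0 : 'I_3).
Local Notation i2 := (ord_max : 'I_3).
Local Notation l2 := (2 * n).-1.
Local Notation l3 := (3 * n).-1.

(* Only the components of degree 2n - 1 of the multipliers q_i matter. *)
Lemma ideal_Dmx (R : comNzRingType) (c : 'I_3 -> idx n -> R) (q : 'I_3 -> {mpoly R[3]}) p :
  p \is l3.-homog -> p = \sum_i q i * form (c i) ->
  exists z, vec l3 p = Dmx c *m z.
Proof.
move=> hp ep; pose q' i := pihomog mdeg l2 (q i).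
have hM (r F : {mpoly R[3]}) : F \is n.-homog ->
    pihomog mdeg l3 (r * F) = pihomog mdeg l2 r * F.
  move=> hF; rewrite [r]mpolyE mulr_suml !raddf_sum mulr_suml; apply: eq_bigr => m _ /=.
  rewrite -scalerAl !linearZ /= -scalerAl; congr (_ *: _).
  have hm : 'X_[m] * F \is (mdeg m + n).-homog by apply: dhomogM; rewrite ?dhomogX /=.
  rewrite pihomogX /=; case: (eqVneq (mdeg m) l2) => [e|ne].
    by rewrite pihomog_dE //; have -> : l3 = (mdeg m + n)%N by rewrite e; lia.
  by rewrite mul0r (pihomog_ne0 _ hm) //; move: ne; lia.
have ep' : p = \sum_i q' i * form (c i).
  rewrite -[LHS](pihomog_dE hp) ep raddf_sum; apply: eq_bigr => i _.
  by rewrite /= hM // form_homog.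
have hq i : q' i \is l2.-homog by apply: pihomogP.
exists (col_mx (vec l2 (q' i0)) (col_mx (vec l2 (q' i1)) (vec l2 (q' i2)))).
by rewrite /Dmx blk_mul !Mul_vec // ep' big_ord3 !vecD addrA.
Qed.

(* The resultant of these forms divides 2; mod 2 they vanish at (0 : 0 : 1). *)
Definition test_form (i : 'I_3) : {mpoly int[3]} :=
  if i == i0 then 'X_i0 * 'X_i2 ^+ n.-1 - 'X_i1 ^+ n
  else if i == i1 then 'X_i1 * 'X_i2 ^+ n.-1
  else 'X_i0 ^+ n + 2 *: 'X_i2 ^+ n.

Definition test_coef (i : 'I_3) (p : idx n) : int := (test_form i)@_(mon p).

Lemma test_form_homog i : test_form i \is n.-homog.
Proof.
have hX j : ('X_j : {mpoly int[3]}) \is 1.-homog by rewrite dhomogX /= mdeg1.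
have hXn j : ('X_j ^+ n : {mpoly int[3]}) \is n.-homog.
  by have := dhomogMn n (hX j); rewrite mul1n.
have hXX j : ('X_j * 'X_i2 ^+ n.-1 : {mpoly int[3]}) \is n.-homog.
  by have := dhomogM (hX j) (dhomogMn n.-1 (hX i2)); rewrite mul1n add1n prednK.
rewrite /test_form; case: ifP => _; last case: ifP => _; rewrite ?rpredB ?rpredD //.
exact: rpredZ.
Qed.

Lemma form_test i : form (test_coef i) = test_form i.
Proof. exact/esym/form_coef/test_form_homog. Qed.

Definition test_ideal (p : {mpoly int[3]}) :=
  exists q, p = \sum_i q i * form (test_coef i).

Lemma test_idealD p p' : test_ideal p -> test_ideal p' -> test_ideal (p + p').
Proof.
move=> [q ->] [q' ->]; exists (fun i => q i + q' i); rewrite -big_split.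
by apply: eq_bigr => i _; rewrite mulrDl.
Qed.

Lemma test_idealM r p : test_ideal p -> test_ideal (r * p).
Proof.
move=> [q ->]; exists (fun i => r * q i); rewrite mulr_sumr.
by apply: eq_bigr => i _; rewrite mulrA.
Qed.

Lemma test_ideal_form i : test_ideal (test_form i).
Proof.
exists (fun j => (j == i)%:R); rewrite (bigD1 i) //= eqxx mul1r form_test.
by rewrite big1 ?addr0 // => j /negPf ->; rewrite mul0r.
Qed.

(** With x, y, z for s, t, u, the ideal contains y z^(n-1), y^(n+1) and x z^(2n-2), and modulo it
    x^n is -2 z^n. In degree 3n - 1, trading x^n for z^n at most twice makes one of these three
    divide the monomial. *)
Lemma test_ideal_mon a b c : (a + b + c = l3)%N -> (0 < a + b)%N ->
  test_ideal ('X_i0 ^+ a * 'X_i1 ^+ b * 'X_i2 ^+ c).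
Proof.
set x := 'X_i0; set y := 'X_i1; set z := 'X_i2.
have F0 r : test_ideal (r * (x * z ^+ n.-1 - y ^+ n)).
  exact/test_idealM/(test_ideal_form i0).
have F1 r : test_ideal (r * (y * z ^+ n.-1)).
  exact/test_idealM/(test_ideal_form i1).
have F2 r : test_ideal (r * (x ^+ n + 2 *: z ^+ n)).
  exact/test_idealM/(test_ideal_form i2).
have E (v : {mpoly int[3]}) k m : (k <= m)%N -> v ^+ m = v ^+ (m - k) * v ^+ k.
  by move=> le; rewrite -exprD subnK.
have yz a' b' c' : (0 < b')%N -> (n.-1 <= c')%N -> test_ideal (x ^+ a' * y ^+ b' * z ^+ c').
  move=> hb hc; have := F1 (x ^+ a' * y ^+ (b' - 1) * z ^+ (c' - n.-1)).
  by rewrite (E y 1%N b') // (E z n.-1 c') // expr1; congr test_ideal; ring.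
have yy a' b' c' : (n < b')%N -> test_ideal (x ^+ a' * y ^+ b' * z ^+ c').
  move=> hb; have := test_idealD (F0 (- (x ^+ a' * y ^+ (b' - n.+1) * z ^+ c' * y)))
    (F1 (x ^+ a' * y ^+ (b' - n.+1) * z ^+ c' * x)).
  by rewrite (E y n.+1 b') // exprS; congr test_ideal; ring.
have xz a' c' : (0 < a')%N -> ((n.-1).*2 <= c')%N -> test_ideal (x ^+ a' * z ^+ c').
  move=> ha hc; have := test_idealD (F0 (x ^+ (a' - 1) * z ^+ (c' - (n.-1).*2) * z ^+ n.-1))
    (F1 (x ^+ (a' - 1) * z ^+ (c' - (n.-1).*2) * y ^+ n.-1)).
  have -> : y ^+ n = y * y ^+ n.-1 by rewrite -exprS prednK.
  rewrite (E x 1%N a') // (E z (n.-1).*2 c') // expr1 -addnn exprD.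
  by congr test_ideal; ring.
have xn a' b' c' : test_ideal (x ^+ a' * y ^+ b' * z ^+ (n + c')) ->
    test_ideal (x ^+ (n + a') * y ^+ b' * z ^+ c').
  move=> h; have := test_idealD (F2 (x ^+ a' * y ^+ b' * z ^+ c')) (test_idealM (- 2%:A) h).
  by rewrite !exprD -!mul_mpolyC; congr test_ideal; ring.
move=> eabc ab0; have [b0|b0] := posnP b.
  rewrite b0 expr0 mulr1; have a0 : (0 < a)%N by lia.
  have [|c1] := leqP (n.-1).*2 c; first exact: xz.
  have xn' a' c' : test_ideal (x ^+ a' * z ^+ (n + c')) -> test_ideal (x ^+ (n + a') * z ^+ c').
    by have := xn a' 0%N c'; rewrite expr0 !mulr1.
  rewrite (_ : a = n + (a - n))%N; last by lia.
  apply: (xn' _ _); have [c2|c2] := leqP (n.-1).*2 (n + c); first by apply: xz => //; lia.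
  rewrite (_ : a - n = n + (a - n - n))%N; last by lia.
  by apply: xn'; apply: xz; lia.
have [|c1] := leqP n.-1 c; first exact: yz.
have [|b1] := ltnP n b; first exact: yy.
rewrite (_ : a = n + (a - n))%N; last by lia.
by apply: xn; apply: yz => //; lia.
Qed.

(** s^n u^(2n-1) is already in the ideal, so the third form times u^(2n-1) leaves only its term 2
    u^(3n-1). *)
Lemma test_ideal_last : test_ideal (2 *: 'X_i2 ^+ l3).
Proof.
have e : l3 = (n + l2)%N by lia.
have h : test_ideal ('X_i0 ^+ n * 'X_i1 ^+ 0 * 'X_i2 ^+ l2).
  by apply: test_ideal_mon; lia.
have := test_idealD (test_idealM ('X_i2 ^+ l2) (test_ideal_form i2)) (test_idealM (-1) h).
by rewrite /test_form /= e exprD -!mul_mpolyC; congr test_ideal; ring.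
Qed.

(** D reaches every monomial except possibly u^(3n-1), and reaches twice that one; preimages taken
    as the columns of X make D X diagonal with a single entry 2 and the others 1. *)
Lemma test_det : exists X, \det (Dmx test_coef *m X) = 2.
Proof.
pose d (p : idx l3) : int := if mon p == tri 0 0 l3 then 2 else 1.
have col_exists (j : 'I_#|idx l3|) : exists z,
    vec l3 (d (enum_val j) *: 'X_[mon (enum_val j)]) = Dmx test_coef *m z.
  set p := enum_val j; have [q eq] : test_ideal (d p *: 'X_[mon p]).
    have -> : ('X_[mon p] : {mpoly int[3]}) = 'X_i0 ^+ mon p i0 * 'X_i1 ^+ mon p i1 * 'X_i2 ^+ mon p i2.
      by rewrite [LHS]mpolyXE_id big_ord3.
    rewrite /d.
    case: eqP => [e|ne].
      by rewrite e !triE !expr0 !mul1r; apply: test_ideal_last.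
    have h := mdeg_mon p; rewrite mdeg3 in h.
    rewrite scale1r; apply: test_ideal_mon => //.
    rewrite lt0n; apply: contra_notN ne; rewrite addn_eq0 => /andP[/eqP h0 /eqP h1].
    by apply: mnm3P; rewrite triE ?h0 ?h1 //; rewrite h0 h1 in h.
  by apply: (ideal_Dmx _ eq); apply: rpredZ; apply: mon_homog.
have [z ez] := fin_all_exists col_exists.
exists (\matrix_(i, j) z j i 0).
have -> : Dmx test_coef *m (\matrix_(i, j) z j i 0) = diag_mx (\row_j d (enum_val j)).
  apply/matrixP => i j; transitivity ((Dmx test_coef *m z j) i 0).
    by rewrite !mxE; apply: eq_bigr => k _; rewrite mxE.
  rewrite -ez !mxE mcoeffZ mcoeffX (inj_eq (@mon_inj l3)) (inj_eq enum_val_inj).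
  by rewrite eq_sym; case: eqP => [->|]; rewrite ?mulr1 ?mulr0.
have [p ep] : {p : idx l3 | mon p = tri 0 0 l3} by apply: mon_surj; rewrite mdeg3 !triE.
rewrite det_diag (bigD1 (enum_rank p)) //= mxE enum_rankK /d ep eqxx big1 ?mulr1 //.
move=> j jp; rewrite mxE -ep (inj_eq (@mon_inj l3)).
by rewrite -[_ == p](inj_eq enum_rank_inj) enum_valK (negPf jp).
Qed.

(** The vanishing criterion for R holds in every characteristic; over an algebraic closure of F_2 it
    gives that the integer value of R reduces to 0. *)
Lemma test_even (R : {mpoly int[#|coef_idx 3 n|]}) : is_resultant R ->
  (2 %| res_at R test_coef)%Z.
Proof.
move=> R_res; have [k [f _]] := countable_algebraic_closure 'F_2.
have ch2 : 2%N \in [pchar k].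
  exact: (rmorph_pchar f (pchar_Fp (isT : prime 2))).
rewrite (dvdz_pcharf ch2) (res_at_morph intr); apply/eqP/(R_res.2 k).
pose v (j : 'I_3) : int := (j == i2)%:R.
exists (fun i => (v i)%:~R); first by exists i2; rewrite /v eqxx oner_neq0.
move=> i; rewrite -(map_form intr) form_test meval_map_mpoly /test_form.
case: ifP => _; last case: ifP => _.
- by rewrite mevalB mevalM !rmorphXn /= !mevalXU /v /= mul0r expr0n gtn_eqF // subr0.
- by rewrite mevalM mevalXU /v /= mul0r.
rewrite mevalD mevalZ !rmorphXn /= !mevalXU /v /= expr0n gtn_eqF // expr1n mulr1 add0r.
exact: (pcharf0 ch2).
Qed.

End UnitExponent.

Lemma resultant_unique (n : nat) (n_gt0 : (0 < n)%N) (K R : {mpoly int[#|coef_idx 3 n|]}) :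
  full0 n_gt0 (@generic n) = K * minor0 (@generic n) -> is_resultant R ->
  R = K \/ R = - K.
Proof.
move=> KP R_res; have [u [j [uu j0 eK]]] := resultant_is_power KP R_res.
have [X dX] := test_det n_gt0.
have e2 := res_at_det KP (@test_coef n) X; rewrite dX eK res_atM res_atXn in e2.
have /dvdzP[m em] := test_even n_gt0 R_res.
(* With j at least 2, evenness of R at the test forms would give that 4 divides 2. *)
have j1 : j = 1%N.
  apply/eqP; rewrite eqn_leq j0 andbT leqNgt; apply/negP => j2.
  have : (4 %| 2)%Z.
    rewrite em -(subnK j2) exprD in e2; apply/dvdzP.
    exists (res_at u (@test_coef n) * (m * 2) ^+ (j - 2) * m ^+ 2 *
      \det (juxt (koszul_dim n_gt0) X (Zmx (@test_coef n)))).
    by rewrite -[LHS]e2; ring.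
  by [].
move: uu; rewrite unfold_in /= => /andP[/eqP eu].
rewrite int_unitE; move: (u@_0%MM) eu => x eu ux.
have [ex|ex] : x = 1 \/ x = -1 by lia.
  by left; rewrite eK j1 expr1 eu ex mpolyC1 mul1r.
by right; rewrite eK j1 expr1 eu ex mpolyCN mpolyC1 mulN1r opprK.
Qed.

(** * The matrices of moving planes and moving quadrics *)

Section ThreeBlocks.

Variable R : comNzRingType.

(* The index of entry r of block i in a vector made of three blocks. *)
Definition bl m (i : 'I_3) (r : 'I_m) : 'I_(m + (m + m)) :=
  if i == ord0 then lshift _ r
  else if i == ord_max then rshift _ (rshift _ r) else rshift _ (lshift _ r).

Definition emb m (i : 'I_3) (v : 'cV[R]_m) : 'cV_(m + (m + m)) :=
  col_mx (if i == ord0 then v else 0)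
    (col_mx (if i == lift ord0 ord0 then v else 0) (if i == ord_max then v else 0)).

Lemma ord3P (P : 'I_3 -> Prop) :
  P ord0 -> P (lift ord0 ord0) -> P ord_max -> forall i, P i.
Proof.
move=> P0 P1 P2; case=> [[|[|[|//]]] lt].
- by have -> : Ordinal lt = ord0 by apply: val_inj.
- by have -> : Ordinal lt = lift ord0 ord0 by apply: val_inj.
- by have -> : Ordinal lt = ord_max by apply: val_inj.
Qed.

Lemma bl_surj m (x : 'I_(m + (m + m))) : exists i r, x = bl i r.
Proof.
rewrite -(splitK x); case: (split x) => [r|y] /=; first by exists ord0, r.
rewrite -(splitK y); case: (split y) => [r|r] /=; first by exists (lift ord0 ord0), r.
by exists ord_max, r.
Qed.

Lemma bl_inj m i i' (r r' : 'I_m) : bl i r = bl i' r' -> i = i' /\ r = r'.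
Proof.
have ltr := ltn_ord r; have ltr' := ltn_ord r'.
move=> /(congr1 (@nat_of_ord _)); rewrite /bl.
elim/ord3P: i; elim/ord3P: i' => /= e; try (exfalso; lia);
  by split; last by apply: val_inj; rewrite /=; lia.
Qed.

Lemma col_blk3 m p (A B C : 'M[R]_(m, p)) i r :
  col (bl i r) (blk A B C) =
    col r (if i == ord0 then A else if i == ord_max then C else B).
Proof.
by apply/colP => j; rewrite mxE [RHS]mxE /blk /bl; elim/ord3P: i;
   rewrite /= ?row_mxEl ?row_mxEr ?row_mxEl ?row_mxEr.
Qed.

Lemma blk_emb m p (A B C : 'M[R]_(m, p)) i v :
  blk A B C *m emb i v = (if i == ord0 then A else if i == ord_max then C else B) *m v.
Proof.
by rewrite /emb blk_mul; elim/ord3P: i; rewrite /= !mulmx0 ?addr0 ?add0r.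
Qed.

Definition diag3 m (M : 'M[R]_m) := block_mx M 0 0 (block_mx M 0 0 M).

Lemma det_diag3 m (M : 'M[R]_m) : \det (diag3 M) = \det M ^+ 3.
Proof. by rewrite !det_ublock. Qed.

Lemma col_diag3 m (M : 'M[R]_m) i r : col (bl i r) (diag3 M) = emb i (col r M).
Proof.
apply/colP => x; have [j [y ->]] := bl_surj x; rewrite mxE.
elim/ord3P: i; elim/ord3P: j; rewrite /diag3 /bl /emb /=.
all: do 2!rewrite ?block_mxEul ?block_mxEur ?block_mxEdl ?block_mxEdr.
all: by do 2!rewrite ?col_mxEu ?col_mxEd; rewrite !mxE.
Qed.

Lemma koszul_col m p (F : 'I_3 -> 'M[R]_(m, p)) (s t : 'I_3) k r :
  (s, t) = (if k == ord0 then (ord0, lift ord0 ord0)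
            else if k == ord_max then (lift ord0 ord0, ord_max) else (ord0, ord_max)) ->
  col (bl k r) (koszul (F ord0) (F (lift ord0 ord0)) (F ord_max)) =
    emb s (col r (F t)) - emb t (col r (F s)).
Proof.
move=> e; rewrite /koszul !col_col_mx !col_blk3 /emb opp_col_mx add_col_mx opp_col_mx add_col_mx.
have colN (A : 'M[R]_(m, p)) : col r (- A) = - col r A by apply/colP => j; rewrite !mxE.
by elim/ord3P: k e => -[-> ->] /=; rewrite ?oppr0 ?addr0 ?add0r ?colN ?col0.
Qed.

End ThreeBlocks.

Lemma det_juxt_sub (R : comNzRingType) a c N (h : (a + c)%N = N) (X : 'M[R]_(N, a))
    (Y : 'M_(N, c)) (B : 'M_(a, c)) :
  \det (juxt h X (X *m B - Y)) = \det (juxt h X Y) * (-1) ^+ c.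
Proof.
rewrite /juxt; case: N / h X Y => X Y; rewrite !castmx_id.
have -> : row_mx X (X *m B - Y) = row_mx X Y *m block_mx 1%:M B 0 (- 1%:M).
  by rewrite mul_row_block !mulmx1 mulmx0 addr0 mulmxN mulmx1.
by rewrite det_mulmx det_ublock det1 mul1r -scaleN1r detZ det1 mulr1.
Qed.

Lemma det_col_inj (R : comNzRingType) m (A B : 'M[R]_m) (f : 'I_m -> 'I_m) :
  injective f -> (forall j, col j A = col (f j) B) -> \det A = \det B \/ \det A = - \det B.
Proof.
move=> f_inj e; have -> : A = col_perm (perm f_inj) B.
  by apply/matrixP => i j; rewrite mxE permE; have /colP/(_ i) := e j; rewrite !mxE.
rewrite col_permE det_mulmx det_perm; case: (odd_perm _).
  by rewrite expr1 mulrN1; right.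
by rewrite expr0 mulr1; left.
Qed.

Section Gamma.

(* The monomials of Gamma0 are the x_i x_j with i <= j and i <= 3. *)
Definition pair_mon (i : 'I_3) (j : 'I_4) : 'X_{1..4} :=
  (U_(widen_ord (leqnSn 3) i) + U_(j))%MM.

Lemma pair_mon_inj (i i' : 'I_3) (j j' : 'I_4) : (i <= j)%N -> (i' <= j')%N ->
  pair_mon i j = pair_mon i' j' -> i = i' /\ j = j'.
Proof.
move=> ij ij' e; suff ei : i = i'.
  split=> //; move/eqP: e; rewrite /pair_mon ei eqm_add2l eq_mnm1 => /eqP //.
have h (x : 'I_4) : ((i == x :> nat) + (j == x) = (i' == x :> nat) + (j' == x))%N.
  by move/mnmP: e => /(_ x); rewrite !mnmDE !mnm1E.
have := h (widen_ord (leqnSn 3) i); have := h (widen_ord (leqnSn 3) i').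
rewrite -!val_eqE /= !eqxx => h1 h2; apply: val_inj => /=; lia.
Qed.

(** i is the least index in the support; it is not the fourth, since the fourth exponent is at most
    1 and the degree is 2. *)
Lemma Gamma0_pair (g : Gamma0) : exists t : 'I_3 * 'I_4,
  (t.1 <= t.2)%N /\ val g = pair_mon t.1 t.2 :> 'X_{1..4}.
Proof.
have /andP[/eqP d2 g3] := valP g; set m := bmnm (val g) in d2 g3 *.
have [i1 mi1] : exists i, m i != 0%N.
  apply/existsP; rewrite -negb_forall; apply: contra_eqN d2 => /forallP m0.
  by rewrite mdegE big1 // => i _; apply/eqP; rewrite m0.
case: (@arg_minnP _ i1 (fun i => m i != 0%N) (fun i => i : nat) mi1) => i mi0 imin.
have le : (U_(i) <= m)%MM by rewrite lep1mP.
have /mdeg1P[j /eqP ej] : mdeg (m - U_(i))%MM == 1%N.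
  by have := mdegD (m - U_(i)) U_(i); rewrite submK // d2 mdeg1 addn1 => -[<-].
have em : m = (U_(i) + U_(j))%MM by rewrite -ej addmC submK.
have ij : (i <= j)%N by apply: imin; rewrite em mnmDE !mnm1E eqxx addn1.
have i3 : (i < 3)%N.
  rewrite ltn_neqAle -ltnS ltn_ord andbT; apply: contraTneq g3 => i3.
  have ei : i = ord_max by apply: val_inj.
  have ej' : j = ord_max by apply: val_inj; have := ltn_ord j; rewrite /=; lia.
  by rewrite em mnmDE !mnm1E ei ej' eqxx.
have ei : widen_ord (leqnSn 3) (Ordinal i3) = i by apply: val_inj.
by exists (Ordinal i3, j); split=> //; rewrite -/m em /pair_mon ei.
Qed.

Lemma pair_mon_Gamma0 (i j : 'I_3) :
  exists g : Gamma0, val g = pair_mon i (widen_ord (leqnSn 3) j) :> 'X_{1..4}.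
Proof.
set m := pair_mon _ _; have dm : mdeg m = 2%N by rewrite mdegD !mdeg1.
have m2 : (mdeg m < 3)%N by rewrite dm.
have mP : (mdeg (BMultinom m2) == 2%N) && (bmnm (BMultinom m2) ord_max <= 1)%N.
  rewrite /= dm /= mnmDE !mnm1E -!val_eqE /=.
  by have := ltn_ord i; have := ltn_ord j; lia.
by exists (exist _ (BMultinom m2) mP).
Qed.

Lemma xpow_pair n (i : 'I_3) (j : 'I_4) :
  xpow n (pair_mon i j) = xform n (widen_ord (leqnSn 3) i) * xform n j.
Proof.
have X1 k : \prod_(l < 4) xform n l ^+ (U_(k)%MM l) = xform n k.
  rewrite (bigD1 k) //= mnm1E eqxx expr1 big1 ?mulr1 // => l lk.
  by rewrite mnm1E eq_sym (negPf lk).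
rewrite -(X1 (widen_ord (leqnSn 3) i)) -[in RHS](X1 j) -big_split.
by apply: eq_bigr => l _; rewrite mnmDE exprD.
Qed.

End Gamma.

(** The pairs in the order of the column blocks of [koszul], the middle one being (0, 2). *)
Definition pair_idx (b : 'I_3) : 'I_3 * 'I_3 :=
  if b == ord0 then (ord0, lift ord0 ord0)
  else if b == ord_max then (lift ord0 ord0, ord_max) else (ord0, ord_max).

Lemma koszul_Mul_col (R : comNzRingType) n (c : 'I_3 -> idx n -> R) b r :
  col (bl b r) (Zmx c) =
  emb (pair_idx b).1 (vec _ ('X_[mon (enum_val r)] * form (c (pair_idx b).2))) -
  emb (pair_idx b).2 (vec _ ('X_[mon (enum_val r)] * form (c (pair_idx b).1))).
Proof.
rewrite -!col_Mul.
by apply: (@koszul_col _ _ _ (fun i => Mul _ _ (form (c i)))); rewrite -surjective_pairing.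
Qed.

Lemma colP_mx (R : Type) m p (A B : 'M[R]_(m, p)) : (forall j, col j A = col j B) -> A = B.
Proof. by move=> e; apply/matrixP => i j; have /colP/(_ i) := e j; rewrite !mxE. Qed.

Section Columns.

Variables (n : nat) (n_gt0 : (0 < n)%N).
Local Notation k := (K n).
Local Notation q := #|idx (2 * n).-1|.
Local Notation a := #|idx (3 * n).-1|.
Local Notation l1 := n.-1.
Local Notation l2 := (2 * n).-1.
Local Notation l3 := (3 * n).-1.
Local Notation widen := (widen_ord (leqnSn 3)).

Definition x123 (i : 'I_3) (p : idx n) : k := coefx (widen i) p.

Local Notation N := (q + (q + q))%N.
Local Notation i0 := (ord0 : 'I_3).
Local Notation i1 := (lift ord0 ord0 : 'I_3).
Local Notation i2 := (ord_max : 'I_3).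
Lemma pair_idx_lt b : ((pair_idx b).1 < (pair_idx b).2)%N.
Proof. by elim/ord3P: b. Qed.

Lemma pair_idx_inj : injective pair_idx.
Proof. by move=> b b'; elim/ord3P: b; elim/ord3P: b'. Qed.

(* For t = (i, (p, j)): the coefficients of X^p x_j in block i of S_(2n-1)^3. *)
Definition blk_col (t : 'I_3 * (idx l1 * 'I_4)) : 'cV[k]_N :=
  emb t.1 (vec l2 ('X_[mon t.2.1] * xform n t.2.2)).

Lemma Dmx_blk_col t : Dmx x123 *m blk_col t =
  vec l3 ('X_[mon t.2.1] * (xform n (widen t.1) * xform n t.2.2)).
Proof.
rewrite /Dmx /blk_col blk_emb.
have -> : (if t.1 == i0 then Mul l2 l3 (form (x123 i0)) else if t.1 == i2 then
    Mul l2 l3 (form (x123 i2)) else Mul l2 l3 (form (x123 i1)))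
    = Mul l2 l3 (xform n (widen t.1)).
  by elim/ord3P: (t.1).
rewrite Mul_vec; first by congr (vec _ _); ring.
have -> : l2 = (l1 + n)%N by lia.
exact: dhomogM (mon_homog _ _) (form_homog _).
Qed.

Lemma col_Zmx b r : col (bl b r) (Zmx x123) =
  blk_col ((pair_idx b).1, (enum_val r, widen (pair_idx b).2)) -
  blk_col ((pair_idx b).2, (enum_val r, widen (pair_idx b).1)).
Proof.
have hx i : form (x123 i) = xform n (widen i) by [].
by rewrite koszul_Mul_col !hx.
Qed.

Variables (I : {set idx n.-1}) (cardI : #|I| = n).
Local Notation M := (MP_I I n_gt0 cardI).

Definition MP_col (s : 'I_q) : idx l1 * 'I_4 :=
  enum_val (cast_ord (esym (MP_square n_gt0 cardI)) s).

Lemma col_MP_I s :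
  col s (MP_I I n_gt0 cardI) = vec l2 ('X_[mon (MP_col s).1] * xform n (MP_col s).2).
Proof.
apply/colP => r; rewrite !mxE castmxE /= cast_ord_id !mxE -/(MP_col s) enum_rankK /=.
rewrite (bigD1 (MP_col s).2) //= ffunE eqxx big1 ?addr0 // => j /negPf nj.
by rewrite ffunE nj /= mul0r.
Qed.

Lemma MP_col_surj p : p \in MP_cols I -> exists s, MP_col s = p.
Proof.
move=> pI; exists (cast_ord (MP_square n_gt0 cardI) (enum_rank_in pI p)).
by rewrite /MP_col cast_ordK enum_rankK_in.
Qed.

Definition MS2_col (s : 'I_a) : idx l1 * Gamma0 :=
  enum_val (cast_ord (esym (MS2_square n_gt0 cardI)) s).

Lemma col_MS2_I s : col s (MS2_I I n_gt0 cardI) =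
  vec l3 ('X_[mon (MS2_col s).1] * xpow n (val (MS2_col s).2)).
Proof.
apply/colP => r; rewrite !mxE castmxE /= cast_ord_id !mxE -/(MS2_col s) enum_rankK /=.
rewrite (bigD1 (MS2_col s).2) //= ffunE eqxx big1 ?addr0 // => j /negPf nj.
by rewrite ffunE nj /= mul0r.
Qed.

Lemma MS2_col_surj p : p \in MS2_cols I -> exists s, MS2_col s = p.
Proof.
move=> pI; exists (cast_ord (MS2_square n_gt0 cardI) (enum_rank_in pI p)).
by rewrite /MS2_col cast_ordK enum_rankK_in.
Qed.

Lemma MS2_col_in s : MS2_col s \in MS2_cols I.
Proof. exact: enum_valP. Qed.

Lemma MS2_col_inj : injective MS2_col.
Proof. by move=> s s' /enum_val_inj /cast_ord_inj. Qed.

Lemma blk_col_diag t : t.2 \in MP_cols I -> exists s, t.2 = MP_col s /\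
  blk_col t = col (bl t.1 s) (diag3 M).
Proof.
move=> /MP_col_surj[s es]; exists s; split=> //.
by rewrite col_diag3 col_MP_I es.
Qed.

End Columns.

(** * Column operations from [X | Z] to three copies of [MP_I] *)

Section Factor.

Variables (n : nat) (n_gt0 : (0 < n)%N) (I : {set idx n.-1}) (cardI : #|I| = n).
Local Notation k := (K n).
Local Notation w := #|idx n.-1|.
Local Notation q := #|idx (2 * n).-1|.
Local Notation a := #|idx (3 * n).-1|.
Local Notation l1 := n.-1.
Local Notation widen := (widen_ord (leqnSn 3)).

Local Notation N := (q + (q + q))%N.
Local Notation W := (w + (w + w))%N.
Local Notation M := (MP_I I n_gt0 cardI).
Local Notation MS2_col := (@MS2_col n n_gt0 I cardI).
Local Notation MP_col := (@MP_col n n_gt0 I cardI).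
Local Notation x123 := (@x123 n).

(** The Koszul column of X^p for i < j is X^p x_j in block i minus X^p x_i in block j, and its first
    term is already a column of X. Removing it leaves the terms whose form index is below the block
    index, while X holds those with i <= j; together they fill each block with the columns of
    [MP_I]. *)
Lemma det_factor : exists2 X : 'M[k]_(N, a), Dmx x123 *m X = MS2_I I n_gt0 cardI &
  \det (juxt (koszul_dim n_gt0) X (Zmx x123)) = \det M ^+ 3 \/
  \det (juxt (koszul_dim n_gt0) X (Zmx x123)) = - \det M ^+ 3.
Proof.
have [t ht] := fin_all_exists Gamma0_pair.
pose keyX (s : 'I_a) := ((t (MS2_col s).2).1,
  ((MS2_col s).1, (t (MS2_col s).2).2)).
have keyX_in s : (keyX s).2 \in MP_cols I.
  have := MS2_col_in n_gt0 cardI s; rewrite !inE /=; apply: contra => /andP[-> /eqP e].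
  have [_ ->] := ht (MS2_col s).2.
  rewrite mnmDE !mnm1E e eqxx -val_eqE /=.
  by rewrite (ltn_eqF (ltn_ord _)).
have keyX_le s : ((keyX s).1 <= (keyX s).2.2)%N by have [] := ht (MS2_col s).2.
have keyX_inj : injective keyX.
  move=> s s' e; apply: (@MS2_col_inj n n_gt0 I cardI).
  have [_ g1] := ht (MS2_col s).2.
  have [_ g2] := ht (MS2_col s').2.
  rewrite [LHS]surjective_pairing [RHS]surjective_pairing.
  case: e => e1 e2 e3; congr (_, _) => //.
  by do 3!apply: val_inj; rewrite /= g1 g2 e1 e3.
(* The fourth form does not occur in x_i x_j here, so the column is kept whatever p is. *)
have keyX_pair (p : idx l1) (i j : 'I_3) : (i < j)%N -> exists s, keyX s = (i, (p, widen j)).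
  move=> ij; have [g eg] := pair_mon_Gamma0 i j.
  have [s es] : exists s, MS2_col s = (p, g).
    apply: (MS2_col_surj n_gt0 cardI); rewrite inE /= eg mnmDE !mnm1E -!val_eqE /=.
    by have := ltn_ord i; have := ltn_ord j; case: (p \in I) => //=; lia.
  exists s; rewrite /keyX es /=; have [t12 et] := ht g.
  have ij' : (i <= widen j)%N by rewrite /= ltnW.
  have [] := pair_mon_inj t12 ij' (etrans (esym et) eg).
  by move=> -> ->.
pose X : 'M[k]_(N, a) := \matrix_(r, s) blk_col (keyX s) r 0.
have colX s : col s X = blk_col (keyX s) by apply/colP => r; rewrite !mxE.
pose keyY (b : 'I_3) (c : 'I_w) : 'I_3 * (idx l1 * 'I_4) :=
  ((pair_idx b).2, (enum_val c, widen (pair_idx b).1)).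
have keyY_in b c : (keyY b c).2 \in MP_cols I.
  rewrite !inE /= -val_eqE /= negb_and; apply/orP; right.
  by have := ltn_ord (pair_idx b).1; lia.
have eDX : Dmx x123 *m X = MS2_I I n_gt0 cardI.
  apply/colP_mx => s.
  rewrite col_mulmx colX (Dmx_blk_col n_gt0) col_MS2_I /=.
  have [_ ->] := ht (MS2_col s).2.
  by rewrite xpow_pair.
exists X => //.
have inv (r : 'I_W) : exists bc : 'I_3 * 'I_w, r = bl bc.1 bc.2.
  by have [b [c e]] := bl_surj r; exists (b, c).
have [bc ebc] := fin_all_exists inv.
pose Y : 'M[k]_(N, W) := \matrix_(i, r) blk_col (keyY (bc r).1 (bc r).2) i 0.
have colY r : col r Y = blk_col (keyY (bc r).1 (bc r).2).
  by apply/colP => i; rewrite !mxE.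
have keyX_all (r : 'I_W) : exists s, keyX s =
    ((pair_idx (bc r).1).1, (enum_val (bc r).2, widen (pair_idx (bc r).1).2)).
  exact/keyX_pair/pair_idx_lt.
have [s es] := fin_all_exists keyX_all.
pose B : 'M[k]_(a, W) := \matrix_(i, r) (i == s r)%:R.
have colXB r : col r (X *m B) = blk_col (keyX (s r)).
  rewrite -colX; apply/colP => i; rewrite mxE mxE [RHS]mxE (bigD1 (s r)) //= big1 => [|j nj].
    by rewrite addr0 [B _ _]mxE eqxx mulr1.
  by rewrite [B _ _]mxE (negPf nj) mulr0.
have eZ : Zmx x123 = X *m B - Y.
  apply/colP_mx => r; rewrite raddfB /= colXB colY es.
  by rewrite {1}(ebc r) col_Zmx.
have dets : \det (juxt (koszul_dim n_gt0) X Y) = \det M ^+ 3 \/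
    \det (juxt (koszul_dim n_gt0) X Y) = - \det M ^+ 3.
  (* Both matrices have N columns, so an injective matching of columns is a permutation; its
     signature is the sign. *)
  pose key (r : 'I_N) := match split (cast_ord (esym (koszul_dim n_gt0)) r) with
    | inl s => keyX s | inr r => keyY (bc r).1 (bc r).2 end.
  have key_in r : (key r).2 \in MP_cols I by rewrite /key; case: split.
  have key_inj : injective key.
    move=> r r'; rewrite /key => e; apply: (@cast_ord_inj _ _ (esym (koszul_dim n_gt0))).
    rewrite -[LHS]splitK -[RHS]splitK.
    (* Keys from X have block index at most the form index, keys from Y have it larger, so the two
       kinds never coincide. *)
    case: split e => x; case: split => y e; congr (unsplit _).
    - by rewrite (keyX_inj _ _ e).
    - have := keyX_le x; rewrite e /keyY /= leqNgt.
      by rewrite pair_idx_lt.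
    - have := keyX_le y; rewrite -e /keyY /= leqNgt.
      by rewrite pair_idx_lt.
    case: e => e1 /enum_val_inj e2 e3.
    have e4 : (bc x).1 = (bc y).1.
      have e5 : (pair_idx (bc x).1).1 = (pair_idx (bc y).1).1 := val_inj e3.
      apply: pair_idx_inj; rewrite [LHS]surjective_pairing [RHS]surjective_pairing.
      by rewrite e1 e5.
    by rewrite (ebc x) (ebc y) e2 e4.
  have colkey r : col r (juxt (koszul_dim n_gt0) X Y) = blk_col (key r).
    apply/colP => i; rewrite mxE /juxt castmxE /= cast_ord_id /key mxE.
    by case: split => x; [rewrite -colX [RHS]mxE|rewrite -colY [RHS]mxE].
  have sel r : exists r', (key r).2 = MP_col r' /\
      blk_col (key r) = col (bl (key r).1 r') (diag3 M).
    exact: blk_col_diag (key_in r).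
  have [f hf] := fin_all_exists sel.
  rewrite -det_diag3; apply: (@det_col_inj _ _ _ _ (fun r => bl (key r).1 (f r))).
    move=> r r' /bl_inj[e1 e2]; apply: key_inj.
    rewrite [LHS]surjective_pairing [RHS]surjective_pairing e1.
    by have [-> _] := hf r; have [-> _] := hf r'; rewrite e2.
  by move=> r; rewrite colkey; have [] := hf r.
rewrite eZ det_juxt_sub; case: dets => ->; rewrite -signr_odd; case: odd;
  by rewrite ?expr0 ?expr1 ?mulr1 ?mulrN1 ?opprK; auto.
Qed.

End Factor.

Theorem corollary5p4 (n : nat) (n_gt0 : (0 < n)%N)
    (R : {mpoly int[#|coef_idx 3 n|]}) (R_res : is_resultant R)
    (I : {set idx n.-1}) (cardI : #|I| = n) :
  \det (MS2_I I n_gt0 cardI) = \det (MP_I I n_gt0 cardI) ^+ 3 * res_x123 R \/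
  \det (MS2_I I n_gt0 cardI) = - (\det (MP_I I n_gt0 cardI) ^+ 3 * res_x123 R).
Proof.
have [K KP] := exists_resultant n_gt0.
have [X <- hX] := det_factor n_gt0 cardI.
have hR : res_x123 R = res_at K (@x123 n) \/ res_x123 R = - res_at K (@x123 n).
  have [->|->] := resultant_unique KP R_res; first by left.
  by right; rewrite /res_x123 /res_at mmapN.
rewrite -(res_at_det KP) mulrC.
by case: hX => ->; case: hR => ->; rewrite ?mulNr ?mulrN ?opprK; auto.
Qed.
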